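(* Let $\lambda\in\mathbb D$ and let $\theta$ be an inner function with $\dim K_\theta>1$. For $\mu\in\mathbb D$ put $\theta_\mu=\dfrac{\tilde k^\theta_\mu}{k^\theta_\mu}$. Then, for any $\mu\in\mathbb D$: (i) $\ker T_{\overline\theta B_\lambda}=(1-\overline\lambda z)\,k^\theta_\mu\,K_{\theta_\mu}$; (ii) $\ker T_{\overline\theta B_\lambda}=m_{\lambda,\theta}\,K_{\theta_\lambda}$, with $\theta_\lambda=\dfrac{\tilde k^\theta_\lambda}{k^\theta_\lambda}$, where $$m_{\lambda,\theta}=\frac{(1-\overline\lambda z)\,k^\theta_\lambda}{\sqrt{1-|\theta(\lambda)|^2}}$$ is an isometric multiplier from $K_{\theta_\lambda}$ onto $\ker T_{\overline\theta B_\lambda}$; (iii) Hayashi's representation of $\ker T_{\overline\theta B_\lambda}$ is given by $$\ker T_{\overline\theta B_\lambda}=m_{\lambda,\theta}\,\frac{k_0^{\theta_\lambda}}{\sqrt{1-|\theta_\lambda(0)|^2}}\;K_{z(\theta_\lambda)_0},\qquad\text{where } (\theta_\lambda)_0=\frac{\tilde k_0^{\theta_\lambda}}{k_0^{\theta_\lambda}}.$$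
   Context: $\mathbb D$ is the open unit disk, $\mathbb T$ the unit circle; $H^2=H^2(\mathbb D)$ is identified with a closed subspace of $L^2(\mathbb T)$, and $P^+:L^2(\mathbb T)\to H^2$ is the orthogonal projection. For $g\in L^\infty(\mathbb T)$, $T_g:H^2\to H^2$, $T_gf=P^+(gf)$. For $\theta$ inner, $K_\theta=\ker T_{\overline\theta}=H^2\ominus\theta H^2$. All these spaces carry the $L^2(\mathbb T)$ norm. For $\lambda\in\mathbb D$, $B_\lambda(z)=\frac{z-\lambda}{1-\overline\lambda z}$. For an inner function $\beta$ and $\lambda\in\mathbb D$, $$\tilde k^\beta_\lambda=\frac{\beta-\beta(\lambda)}{z-\lambda},\qquad k^\beta_\lambda=\frac{1-\overline{\beta(\lambda)}\,\beta}{1-\overline\lambda z};$$ when $\beta$ is non-constant, $\tilde k^\beta_\lambda/k^\beta_\lambda$ is an inner function. An isometric multiplier from $\mathcal A$ onto $\mathcal B$ is a function $m$ such that $f\mapsto mf$ is an isometry from $\mathcal A$ onto $\mathcal B$. Hayashi's representation of a nontrivial Toeplitz kernel $\ker T_g$ is the representation $\ker T_g=u\,K_{z\gamma}$ with $u$ outer, $\gamma$ inner and multiplication by $u$ an isometry from $K_{z\gamma}$ onto $\ker T_g$; it exists and is unique up to a unimodular constant. *)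

(* Defs.v *)
From HB Require Import structures.
From mathcomp Require Import all_boot all_order all_algebra.
From mathcomp Require Import complex.
From mathcomp Require Import all_classical all_reals all_analysis.
Import Order.TTheory GRing.Theory Num.Theory.
Import numFieldNormedType.Exports.

Set Implicit Arguments.
Unset Strict Implicit.
Unset Printing Implicit Defensive.

Local Open Scope classical_set_scope.
Local Open Scope ring_scope.

(* Complex numbers are R[i], with R : realType and real-valued modulus [normc].
   A function on the unit circle is a total function f : R[i] -> R[i] of which
   only the values f (expi t), 0 <= t <= 2 pi, matter; elements of L^2(T) are
   such functions considered up to [eqT], i.e. almost everywhere equality.
   Sets of functions below are closed under [eqT] of measurable functions, so
   that equality of sets is equality of the corresponding subsets of L^2(T). *)

Definition disk (R : realType) (z : R[i]) : Prop := Normc.normc z < 1.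

Definition expi (R : realType) (t : R) : R[i] := Complex (cos t) (sin t).

Definition cexp (R : realType) (w : R[i]) : R[i] :=
  (expR (complex.Re w))%:C%C * expi (complex.Im w).

Definition arc (R : realType) : set R := `[0, 2 * pi]%classic.
Arguments arc : clear implicits.

Definition eqT (R : realType) (f g : R[i] -> R[i]) : Prop :=
  {ae lebesgue_measure, forall t : R, arc R t -> f (expi t) = g (expi t)}.

Definition measT (R : realType) (f : R[i] -> R[i]) : Prop :=
  measurable_fun (arc R) (fun t => complex.Re (f (expi t))) /\
  measurable_fun (arc R) (fun t => complex.Im (f (expi t))).

(* integral against normalized arc length dt / (2 pi) *)
Definition meanT (R : realType) (f : R -> R) : R :=
  (2 * pi)^-1 * (\int[lebesgue_measure]_(t in arc R) f t)%R.

Definition intT (R : realType) (f : R[i] -> R[i]) : R[i] :=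
  Complex (meanT (fun t => complex.Re (f (expi t))))
          (meanT (fun t => complex.Im (f (expi t)))).

Definition L2T (R : realType) (f : R[i] -> R[i]) : Prop :=
  measT f /\
  lebesgue_measure.-integrable (arc R)
    (fun t => (Normc.normc (f (expi t)) ^+ 2)%:E).

Definition normT (R : realType) (f : R[i] -> R[i]) : R :=
  Num.sqrt (meanT (fun t => Normc.normc (f (expi t)) ^+ 2)).

Definition innerT (R : realType) (f g : R[i] -> R[i]) : R[i] :=
  intT (fun z => f z * conjc (g z)).

(* H^2(D): F is the sum on D of a power series with square-summable
   coefficients; values of F outside D are irrelevant. *)
Definition hardy_disk (R : realType) (F : R[i] -> R[i]) : Prop :=
  exists a : nat -> R[i],
    cvgn (series (fun n => Normc.normc (a n) ^+ 2)) /\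
    forall z, disk z ->
      (fun N => Normc.normc (\sum_(n < N) a n * z ^+ n - F z)) @ \oo
        --> (0 : R).

(* f in L^2(T) is the boundary function of F in H^2(D): the L^2(T) limit of
   the dilates F(r .) as r tends to 1 from below. *)
Definition hardy_boundary (R : realType) (F f : R[i] -> R[i]) : Prop :=
  [/\ hardy_disk F, L2T f &
      normT (fun z => F (r%:C%C * z) - f z) @[r --> (1 : R)^'-] --> (0 : R)].

(* H^2 as a subspace of L^2(T) *)
Definition H2 (R : realType) : set (R[i] -> R[i]) :=
  [set f | exists F, hardy_boundary F f].

(* f(z) for f in H^2, given by its boundary values, and z in D; well defined
   since F is determined on D by f. *)
Definition hval (R : realType) (f : R[i] -> R[i]) (z : R[i]) : R[i] :=
  xget 0 [set w | exists2 F, hardy_boundary F f & w = F z].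

Definition inner (R : realType) (f : R[i] -> R[i]) : Prop :=
  (exists F, hardy_boundary F f /\
     exists M : R, forall z, disk z -> Normc.normc (F z) <= M) /\
  {ae lebesgue_measure,
    forall t : R, arc R t -> Normc.normc (f (expi t)) = 1}.

(* u(z) = c exp (1/(2 pi) int (e^it + z)/(e^it - z) log |u(e^it)| dt), |c| = 1 *)
Definition outer (R : realType) (u : R[i] -> R[i]) : Prop :=
  [/\ H2 u,
      lebesgue_measure.-integrable (arc R)
        (fun t => (ln (Normc.normc (u (expi t))))%:E) &
      exists c : R[i], Normc.normc c = 1 /\
        forall z, disk z ->
          hval u z = c * cexp (intT (fun w =>
            (w + z) / (w - z) * (ln (Normc.normc (u w)))%:C%C))].

(* p = P^+ h, the orthogonal projection of h on H^2 *)
Definition is_projH2 (R : realType) (h p : R[i] -> R[i]) : Prop :=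
  H2 p /\ forall q, H2 q -> innerT (fun z => h z - p z) q = 0.

(* h = T_g f *)
Definition is_toeplitz (R : realType) (g f h : R[i] -> R[i]) : Prop :=
  is_projH2 (fun z => g z * f z) h.

Definition kerT (R : realType) (g : R[i] -> R[i]) : set (R[i] -> R[i]) :=
  [set f | H2 f /\ is_toeplitz g f (fun=> 0)].

Definition modelK (R : realType) (th : R[i] -> R[i]) : set (R[i] -> R[i]) :=
  kerT (fun z => conjc (th z)).

Definition dim_gt (R : realType) (n : nat) (V : set (R[i] -> R[i])) : Prop :=
  exists v : 'I_n.+1 -> R[i] -> R[i],
    (forall i, V (v i)) /\
    forall c : 'I_n.+1 -> R[i],
      eqT (fun z => \sum_i c i * v i z) (fun=> 0) -> forall i, c i = 0.

Definition blaschke (R : realType) (l z : R[i]) : R[i] :=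
  (z - l) / (1 - conjc l * z).

(* The next three are used on T only, where neither denominator vanishes (up to
   a null set for the quotient); in particular z = l does not occur, and values
   on D are taken through [hval]. *)
Definition ktilde (R : realType) (b : R[i] -> R[i]) (l z : R[i]) : R[i] :=
  (b z - hval b l) / (z - l).

Definition kker (R : realType) (b : R[i] -> R[i]) (l z : R[i]) : R[i] :=
  (1 - conjc (hval b l) * b z) / (1 - conjc l * z).

Definition sub_inner (R : realType) (b : R[i] -> R[i]) (l z : R[i]) : R[i] :=
  ktilde b l z / kker b l z.

(* the set m A *)
Definition mulset (R : realType) (m : R[i] -> R[i]) (A : set (R[i] -> R[i])) :
    set (R[i] -> R[i]) :=
  [set g | measT g /\ exists2 f, A f & eqT g (fun z => m z * f z)].

Definition isometric_multiplier (R : realType) (m : R[i] -> R[i])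
    (A B : set (R[i] -> R[i])) : Prop :=
  [/\ forall f, A f -> B (fun z => m z * f z),
      forall f, A f -> normT (fun z => m z * f z) = normT f &
      forall g, B g -> exists2 f, A f & eqT g (fun z => m z * f z)].

Definition hayashi_rep (R : realType) (g u gam : R[i] -> R[i]) : Prop :=
  [/\ exists2 f, kerT g f & ~ eqT f (fun=> 0),
      outer u,
      inner gam,
      kerT g = mulset u (modelK (fun z => z * gam z)) &
      isometric_multiplier u (modelK (fun z => z * gam z)) (kerT g)].

Definition m_mult (R : realType) (l : R[i]) (th : R[i] -> R[i]) (z : R[i]) :
    R[i] :=
  (1 - conjc l * z) * kker th l z /
  (Num.sqrt (1 - Normc.normc (hval th l) ^+ 2))%:C%C.

(* Main.v *)
Require Import Defs.
From mathcomp Require Import all_boot all_order all_algebra.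
From mathcomp Require Import complex.
From mathcomp Require Import all_classical all_reals all_analysis.
From mathcomp Require Import measurable_realfun ring lra.
Import Order.TTheory GRing.Theory Num.Theory.
Import numFieldNormedType.Exports.
Import Defs.

(** Why the theorem holds. Write a = th(mu), k = kker th mu and w = (1 - conj lam z) k.
    The function w is invertible in H^oo. On the unit circle |th| = 1 gives
    ktilde th mu = th conj (z k), so th_mu = th conj (z k) / k is unimodular; it lies in
    H^oo because (th - a) / (z - mu) does and 1 / k is bounded. The same identity reads
      conj th B_lam w = conj w conj th_mu
    on the circle. Multiplication by conj w preserves the orthogonal complement of H^2,
    hence w h lies in the kernel of the symbol conj th B_lam exactly when h lies in
    K_(th_mu); this is (i) (kerT_transfer, kerT_blaschke).

    For mu = lam the multiplier is 1 - conj a th up to a constant. Since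
    th - a = (z - lam) k th_lam, the function (th - a) h is orthogonal to h for h in
    K_(th_lam), that is <th h, h> = a |h|^2, and expanding the square yields
    |(1 - conj a th) h|^2 = (1 - |a|^2) |h|^2 (sqT_crofoot); this is (ii).

    For (iii) put phi = th_lam and b = phi(0). The Frostman shift
    (phi - b) / (1 - conj b phi) equals z phi_0, and the two arguments above, applied to
    the multiplier 1 - conj b phi, carry K_(z phi_0) isometrically onto K_phi
    (modelK_crofoot). The composed multiplier is a positive constant times
    (1 - conj a th) (1 - conj b phi). Both factors are exponentials of bounded analytic
    functions, the logarithms being uniform limits of Taylor polynomials, so the
    multiplier is outer by the Schwarz integral formula (herglotz, outer_prod_1B). The
    hypothesis on the dimension enters twice: an inner function with K_th nonzero is not
    constant, so |th(mu)| < 1 (hval_inner_lt1); and an element of K_th that vanishes at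
    lam, divided by B_lam, is a nonzero element of the kernel, which makes K_phi nonzero
    and |b| < 1 (modelK_vanishing, kerT_blaschke_div).

    The Hardy space enters through one fact: a function belongs to H^2 exactly when it is
    an L^2 limit of polynomials, and its value at z is then its inner product with the
    Szego kernel (H2_polycl, hval_hev). Stability of H^2 under products, division by
    w - z and composition, multiplicativity of point values and the maximum principle all
    follow by approximation. *)

Set Implicit Arguments.
Unset Strict Implicit.
Unset Printing Implicit Defensive.
Local Open Scope classical_set_scope.
Local Open Scope ring_scope.

Notation normc := Normc.normc.

(** * Complex modulus and the unit circle *)

Section complex_modulus.
Variable R : realType.
Implicit Types z w : R[i].

Lemma normc_ge0 z : 0 <= normc z.
Proof. by case: z => a b; exact: sqrtr_ge0. Qed.

Lemma normc_sqr z : normc z ^+ 2 = complex.Re z ^+ 2 + complex.Im z ^+ 2.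
Proof. by case: z => a b /=; rewrite sqr_sqrtr// addr_ge0 ?sqr_ge0. Qed.

Lemma mul_conjc z : z * conjc z = (normc z ^+ 2)%:C%C.
Proof.
rewrite normc_sqr; case: z => a b /=; apply/eqP; rewrite eq_complex /=.
by apply/andP; split; apply/eqP; ring.
Qed.

Lemma normcJ z : normc (conjc z) = normc z.
Proof. by case: z => a b /=; rewrite sqrrN. Qed.

Lemma normcB z w : normc (z - w) = normc (w - z).
Proof. by rewrite -(normcN (z - w)) opprB. Qed.

Lemma normcX z n : normc (z ^+ n) = normc z ^+ n.
Proof.
by elim: n => [|n IH]; rewrite ?expr0 ?Normc.normc1// !exprS Normc.normcM IH.
Qed.

Lemma normcR (x : R) : normc x%:C%C = `|x|.
Proof. by rewrite /= expr0n addr0 sqrtr_sqr. Qed.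

Lemma normc_eq0 z : (normc z == 0) = (z == 0).
Proof.
by apply/eqP/eqP => [/Normc.eq0_normc//|->]; exact: Normc.normc0.
Qed.

Lemma normc_gt0 z : (0 < normc z) = (z != 0).
Proof. by rewrite lt_def normc_eq0 normc_ge0 andbT. Qed.

Lemma Re_le_normc z : `|complex.Re z| <= normc z.
Proof.
rewrite -(ler_pXn2r (n := 2)) ?nnegrE ?normc_ge0// normc_sqr real_normK ?num_real//.
by rewrite lerDl sqr_ge0.
Qed.

Lemma Im_le_normc z : `|complex.Im z| <= normc z.
Proof.
rewrite -(ler_pXn2r (n := 2)) ?nnegrE ?normc_ge0// normc_sqr real_normK ?num_real//.
by rewrite lerDr sqr_ge0.
Qed.

Lemma normc_le_ReIm z : normc z <= `|complex.Re z| + `|complex.Im z|.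
Proof.
rewrite -(ler_pXn2r (n := 2)) ?nnegrE ?normc_ge0 ?addr_ge0// normc_sqr sqrrD.
rewrite !real_normK ?num_real// -addrA lerD2l lerDr.
by rewrite mulrn_wge0// mulr_ge0.
Qed.

Lemma normc_sqrD_le z w :
  normc (z + w) ^+ 2 <= 2 * normc z ^+ 2 + 2 * normc w ^+ 2.
Proof.
rewrite !normc_sqr; case: z => a b; case: w => c d /=.
have := sqr_ge0 (a - c); have := sqr_ge0 (b - d); lra.
Qed.

Lemma normc_sum (I : Type) (r : seq I) (P : pred I) (F : I -> R[i]) :
  normc (\sum_(i <- r | P i) F i) <= \sum_(i <- r | P i) normc (F i).
Proof.
elim/big_ind2 : _ => //; first by rewrite Normc.normc0.
by move=> x1 x2 y1 y2 h1 h2; exact/(le_trans (le_normcD _ _))/lerD.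
Qed.

Lemma Re_add z w : complex.Re (z + w) = complex.Re z + complex.Re w.
Proof. by case: z; case: w. Qed.

Lemma Im_add z w : complex.Im (z + w) = complex.Im z + complex.Im w.
Proof. by case: z; case: w. Qed.

Lemma Re_mul z w : complex.Re (z * w) =
  complex.Re z * complex.Re w - complex.Im z * complex.Im w.
Proof. by case: z; case: w. Qed.

Lemma Im_mul z w : complex.Im (z * w) =
  complex.Re z * complex.Im w + complex.Im z * complex.Re w.
Proof. by case: z => a b; case: w => c d. Qed.

Lemma complex_eq z w : complex.Re z = complex.Re w ->
  complex.Im z = complex.Im w -> z = w.
Proof. by case: z => a b; case: w => c d /= -> ->. Qed.

Lemma invc_conjc z : z^-1 = conjc z * ((normc z ^+ 2)^-1)%:C%C.
Proof.
have [->|z0] := eqVneq z 0; first by rewrite invr0 conjc0 mul0r.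
rewrite fmorphV/= -mul_conjc; field; by rewrite fmorph_eq0 z0.
Qed.

Lemma unit_conjc z : normc z = 1 -> z * conjc z = 1.
Proof. by move=> z1; rewrite mul_conjc z1 expr1n. Qed.

Lemma unit_neq0 z : normc z = 1 -> z != 0.
Proof. by move=> z1; rewrite -normc_gt0 z1. Qed.

Lemma unit_conjV z : normc z = 1 -> conjc z = z^-1.
Proof.
by move=> z1; apply: (mulfI (unit_neq0 z1)); rewrite unit_conjc// divff ?unit_neq0.
Qed.

Lemma normc_subr z w : normc z - normc w <= normc (z - w).
Proof. by rewrite lerBlDr; have := le_normcD (z - w) w; rewrite subrK. Qed.

Lemma normc_expi (t : R) : normc (expi t) = 1.
Proof. by rewrite /= cos2Dsin2 sqrtr1. Qed.

Lemma expi_addr (s t : R) : expi (s + t) = expi s * expi t.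
Proof.
rewrite /expi cosD sinD; apply/eqP; rewrite eq_complex/=.
by apply/andP; split; apply/eqP; ring.
Qed.

Lemma expi_exp (t : R) n : expi t ^+ n = expi (n%:R * t).
Proof.
elim: n => [|n IH]; first by rewrite mul0r /expi cos0 sin0.
by rewrite exprS IH -expi_addr -{1}(mul1r t) -mulrDl -natr1 addrC.
Qed.

Lemma conjcD z w : conjc (z + w) = conjc z + conjc w.
Proof. exact: rmorphD. Qed.

Lemma conjcB z w : conjc (z - w) = conjc z - conjc w.
Proof. exact: rmorphB. Qed.

Lemma conjcM z w : conjc (z * w) = conjc z * conjc w.
Proof. exact: rmorphM. Qed.

Lemma conjcV z : conjc z^-1 = (conjc z)^-1.
Proof. exact: fmorphV. Qed.

Lemma conjcX z n : conjc (z ^+ n) = conjc z ^+ n.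
Proof. exact: rmorphXn. Qed.

End complex_modulus.

Lemma cvg_dominated (R : realType) (T : Type) (F : set_system T) (FF : Filter F)
    (u v : T -> R) (l : R) :
  (forall x, `|u x - l| <= v x) -> v @ F --> (0 : R) -> u @ F --> l.
Proof.
move=> uv v0; apply/cvgrPdist_le => e e0.
have /cvgrPdist_le/(_ e e0) := v0; apply: filterS => x.
rewrite sub0r normrN => vx; rewrite distrC.
by apply: le_trans (uv x) _; apply: le_trans vx; exact: ler_norm.
Qed.

(** * Measurability on the circle *)

Section measurability.
Variable R : realType.
Implicit Types f g : R[i] -> R[i].

Definition aeT (P : R[i] -> Prop) : Prop :=
  {ae lebesgue_measure, forall t : R, arc R t -> P (expi t)}.

Lemma aeT_mp (P Q : R[i] -> Prop) :
  (forall z, normc z = 1 -> P z -> Q z) -> aeT P -> aeT Q.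
Proof.
move=> PQ; apply: (@filterS _ _ (ae_filter_ringOfSetsType _)) => t h /h; apply: PQ; exact: normc_expi.
Qed.

Lemma aeT_all (P : R[i] -> Prop) : (forall z, normc z = 1 -> P z) -> aeT P.
Proof. by move=> h; apply: aeW => t _; apply: h; exact: normc_expi. Qed.

Lemma aeT_and (P Q : R[i] -> Prop) : aeT P -> aeT Q -> aeT (fun z => P z /\ Q z).
Proof. by apply: (@filterS2 _ _ (ae_filter_ringOfSetsType _)) => t h k /[dup] /h ? /k. Qed.

Lemma arc_mu : lebesgue_measure (arc R) = (2 * pi)%:E.
Proof.
by rewrite lebesgue_measure_itv/= lte_fin mulr_gt0 ?pi_gt0// sube0.
Qed.

Lemma measurable_inv (D : set R) (f : R -> R) : (forall t, D t -> 0 <= f t) ->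
  measurable_fun D f -> measurable_fun D (fun t => (f t)^-1).
Proof.
move=> f0 mf; apply: (eq_measurable_fun (fun t => f t `^ (-1))).
  by move=> t /set_mem tD; rewrite -powR_inv1// f0.
apply: (measurableT_comp (measurable_powR _)); exact: mf.
Qed.

Lemma measT_cst (c : R[i]) : measT (fun=> c).
Proof. by split; exact: measurable_cst. Qed.

Lemma measT_id : measT (fun z : R[i] => z).
Proof.
split => /=; apply: measurable_funTS; apply: continuous_measurable_fun.
- exact: continuous_cos.
- exact: continuous_sin.
Qed.

Lemma measT_add f g : measT f -> measT g -> measT (fun z => f z + g z).
Proof.
move=> [f1 f2] [g1 g2]; split.
- under eq_fun do rewrite Re_add; exact: measurable_funD.
- under eq_fun do rewrite Im_add; exact: measurable_funD.
Qed.

Lemma measT_mul f g : measT f -> measT g -> measT (fun z => f z * g z).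
Proof.
move=> [f1 f2] [g1 g2]; split.
- under eq_fun do rewrite Re_mul.
  by apply: measurable_funB; apply: measurable_funM.
- under eq_fun do rewrite Im_mul.
  by apply: measurable_funD; apply: measurable_funM.
Qed.

Lemma measT_opp f : measT f -> measT (fun z => - f z).
Proof.
move=> mf; have := measT_mul (measT_cst (-1)) mf.
by congr measT; apply/funext => z; rewrite mulN1r.
Qed.

Lemma measT_sub f g : measT f -> measT g -> measT (fun z => f z - g z).
Proof. by move=> mf mg; apply: measT_add => //; exact: measT_opp. Qed.

Lemma measT_conj f : measT f -> measT (fun z => conjc (f z)).
Proof.
move=> [f1 f2]; split.
- by apply: eq_measurable_fun f1 => t _; case: (f _).
- apply: eq_measurable_fun (measurable_funN f2) => t _.
  by rewrite /=; case: (f _).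
Qed.

Lemma measT_real (h : R -> R) : measurable_fun (arc R) h -> forall f,
  (forall t, arc R t -> f (expi t) = (h t)%:C%C) -> measT f.
Proof.
move=> mh f fh; split.
- by apply: eq_measurable_fun mh => t /set_mem/fh ->.
- apply: (eq_measurable_fun (fun _ : R => 0 : R)); last exact: measurable_cst.
  by move=> t /set_mem/fh ->.
Qed.

Lemma measurable_normc_sqr f : measT f ->
  measurable_fun (arc R) (fun t => normc (f (expi t)) ^+ 2).
Proof.
move=> [f1 f2]; under eq_fun do rewrite normc_sqr.
by apply: measurable_funD; apply: measurable_funX.
Qed.

Lemma measT_inv f : measT f -> measT (fun z => (f z)^-1).
Proof.
move=> mf; have -> : (fun z => (f z)^-1) =
    (fun z => conjc (f z) * ((normc (f z) ^+ 2)^-1)%:C%C).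
  by apply/funext => z; exact: invc_conjc.
apply: measT_mul (measT_conj mf) _.
apply: measT_real; last by move=> t _; reflexivity.
apply: measurable_inv; last exact: measurable_normc_sqr.
by move=> t _; exact: sqr_ge0.
Qed.

Lemma measT_div f g : measT f -> measT g -> measT (fun z => f z / g z).
Proof. by move=> mf mg; apply: measT_mul => //; exact: measT_inv. Qed.

Lemma measT_eq f g : (forall z, normc z = 1 -> f z = g z) -> measT f -> measT g.
Proof.
move=> fg [f1 f2]; split; [apply: eq_measurable_fun f1|apply: eq_measurable_fun f2];
  by move=> t _; rewrite fg// normc_expi.
Qed.

Lemma measT_sum n (f : nat -> R[i] -> R[i]) : (forall k, measT (f k)) ->
  measT (fun z => \sum_(k < n) f k z).
Proof.
move=> mf; elim: n => [|n IH].
  by under eq_fun do rewrite big_ord0; exact: measT_cst.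
by under eq_fun do rewrite big_ord_recr; exact: measT_add.
Qed.

Lemma measT_exp f n : measT f -> measT (fun z => f z ^+ n).
Proof.
move=> mf; elim: n => [|n IH]; first exact: measT_cst.
by under eq_fun do rewrite exprS; exact: measT_mul.
Qed.

Lemma measT_horner (p : {poly R[i]}) f : measT f -> measT (fun z => p.[f z]).
Proof.
move=> mf; under eq_fun do rewrite horner_coef.
by apply: (@measT_sum _ (fun k z => p`_k * f z ^+ k)) => k;
  apply: measT_mul (measT_cst _) _; exact: measT_exp.
Qed.

Lemma measT_cvg (h : nat -> R[i] -> R[i]) f : (forall n, measT (h n)) ->
  (forall z, normc z = 1 -> (fun n => normc (h n z - f z)) @ \oo --> (0 : R)) ->
  measT f.
Proof.
move=> mh hf; split.
- apply: (measurable_fun_cvg (fun n => (mh n).1)) => t _.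
  apply: cvg_dominated (hf _ (normc_expi t)) => n.
  by apply: le_trans (Re_le_normc _); rewrite Re_add; case: (f _).
- apply: (measurable_fun_cvg (fun n => (mh n).2)) => t _.
  apply: cvg_dominated (hf _ (normc_expi t)) => n.
  by apply: le_trans (Im_le_normc _); rewrite Im_add; case: (f _).
Qed.

End measurability.

(** * Means over the circle *)

Section mean.
Variable R : realType.
Implicit Types h k : R -> R.

Local Notation intg h :=
  (lebesgue_measure.-integrable (arc R) (fun t : R => (h t)%:E)).

(** R carries two displays with the same Borel sets, its own and that of the
    domain of Lebesgue measure; integrals refer to the second one. *)
Let mA : measurable (arc R : set (measurableTypeR R)).
Proof. exact: measurable_itv. Qed.

Let toLebesgue h : measurable_fun (arc R) h ->
  measurable_fun (arc R : set (measurableTypeR R)) (EFin \o h).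
Proof. by move=> mh; apply/measurable_EFinP; exact: mh. Qed.

Lemma intgD h k : intg h -> intg k -> intg (fun t => h t + k t).
Proof. by move=> ih ik; exact: (integrableD mA ih ik). Qed.

Lemma intgZ (c : R) h : intg h -> intg (fun t => c * h t).
Proof. by move=> ih; exact: (integrableZl mA c ih). Qed.

Lemma intg_dominated h k : measurable_fun (arc R) h -> intg k ->
  (forall t, arc R t -> `|h t| <= k t) -> intg h.
Proof.
move=> mh ik hk; apply: (le_integrable mA _ _ ik).
  exact: toLebesgue.
move=> t tA /=; rewrite lee_fin; apply: le_trans (hk t tA) _; exact: ler_norm.
Qed.

Lemma intg_cst (c : R) : intg (fun=> c).
Proof.
apply: (measurable_bounded_integrable (f := fun=> c) mA).
- rewrite /= arc_mu; exact: ltry.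
- exact: measurable_cst.
- exists `|c|; split; first exact: num_real.
  by move=> x cx t _ /=; exact: ltW.
Qed.

Lemma meanT_ge0 h : (forall t, 0 <= h t) -> 0 <= meanT h.
Proof.
move=> h0; apply: mulr_ge0; first by rewrite invr_ge0 mulr_ge0 ?pi_ge0.
exact: Rintegral_ge0.
Qed.

Lemma meanTD h k : intg h -> intg k ->
  meanT (fun t => h t + k t) = meanT h + meanT k.
Proof.
by move=> ih ik; rewrite /meanT (RintegralD mA ih ik) mulrDr.
Qed.

Lemma meanTZ (c : R) h : intg h -> meanT (fun t => c * h t) = c * meanT h.
Proof.
by move=> ih; rewrite /meanT (RintegralZl c mA ih) mulrCA.
Qed.

Lemma meanT_cst (c : R) : meanT (fun=> c) = c.
Proof.
rewrite /meanT Rintegral_cst; last exact: mA.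
rewrite /= arc_mu/=.
by rewrite mulrCA mulVf ?mulr1// mulf_neq0// gt_eqF// pi_gt0.
Qed.

Lemma eq_meanT h k : (forall t, arc R t -> h t = k t) -> meanT h = meanT k.
Proof.
by move=> hk; congr (_ * _); apply: eq_Rintegral => t /set_mem/hk.
Qed.

Lemma meanT_ae h k : measurable_fun (arc R) h -> measurable_fun (arc R) k ->
  {ae lebesgue_measure, forall t : R, arc R t -> h t = k t} ->
  meanT h = meanT k.
Proof.
move=> mh mk hk; congr (_ * fine _); apply: ae_eq_integral.
- exact: mA.
- exact: toLebesgue.
- exact: toLebesgue.
- apply: (@filterS _ _ (ae_filter_ringOfSetsType _)) hk => t hk tA.
  by rewrite hk.
Qed.

Lemma meanT_eq0 h : (forall t, 0 <= h t) -> intg h -> meanT h = 0 ->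
  {ae lebesgue_measure, forall t : R, arc R t -> h t = 0}.
Proof.
move=> h0 ih /eqP; rewrite mulf_eq0 invr_eq0 mulf_eq0 pnatr_eq0/=.
rewrite gt_eqF ?pi_gt0//= => /eqP I0.
have : (\int[lebesgue_measure]_(t in arc R) `|(h t)%:E|)%E = 0%E.
  under eq_integral do rewrite gee0_abs ?lee_fin//.
  by rewrite -(fineK (integrable_fin_num mA ih)); congr (_ %:E).
move/(ae_eq_integral_abs _ mA) => H.
have := H (measurable_int _ ih).
apply: (@filterS _ _ (ae_filter_ringOfSetsType _)) => t ht tA.
by have [] := ht tA.
Qed.

Lemma meanT_dominated h k (M : R) : measurable_fun (arc R) h -> intg k ->
  (forall t, 0 <= h t) -> (forall t, 0 <= k t) -> 0 <= M ->
  {ae lebesgue_measure, forall t : R, arc R t -> h t <= M * k t} ->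
  intg h /\ meanT h <= M * meanT k.
Proof.
move=> mh ik h0 k0 M0 hk.
have iMk := intgZ M ik.
have le_int : (\int[lebesgue_measure]_(t in arc R) (h t)%:E <=
    \int[lebesgue_measure]_(t in arc R) (M * k t)%:E)%E.
  apply: ae_ge0_le_integral.
  - exact: mA.
  - by move=> t _; rewrite lee_fin.
  - exact: toLebesgue.
  - by move=> t _; rewrite lee_fin mulr_ge0.
  - exact: measurable_int iMk.
  - apply: (@filterS _ _ (ae_filter_ringOfSetsType _)) hk => t hk tA.
    by rewrite lee_fin hk.
have finMk := integrable_fin_num mA iMk.
have lt_int : (\int[lebesgue_measure]_(t in arc R) (h t)%:E < +oo)%E.
  by apply: le_lt_trans le_int _; rewrite -(fineK finMk) ltry.
have ih : intg h.
  apply/integrableP; split; first exact: toLebesgue.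
  by under eq_integral do rewrite gee0_abs ?lee_fin//.
split => //; rewrite -meanTZ// /meanT ler_wpM2l//.
  by rewrite invr_ge0 mulr_ge0 ?pi_ge0.
apply: fine_le => //; exact: integrable_fin_num ih.
Qed.

End mean.

(** * Square-integrable functions *)

Section square_integrable.
Variable R : realType.
Implicit Types (f g h : R[i] -> R[i]) (c : R[i]).

Local Notation intg h :=
  (lebesgue_measure.-integrable (arc R) (fun t : R => (h t)%:E)).

(** Squared norms replace norms: |f + g|^2 <= 2 |f|^2 + 2 |g|^2 suffices for every
    limit argument below, and no square roots appear. *)
Definition sqT f : R := meanT (fun t => normc (f (expi t)) ^+ 2).

Definition L1T f : Prop :=
  [/\ measT f, intg (fun t => complex.Re (f (expi t))) &
      intg (fun t => complex.Im (f (expi t)))].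

Lemma eqT_aeT f g : eqT f g -> aeT (fun z => f z = g z).
Proof. by []. Qed.

Lemma eqT_mp (P : R[i] -> Prop) f g :
  (forall z, normc z = 1 -> P z -> f z = g z) -> aeT P -> eqT f g.
Proof. exact: aeT_mp. Qed.

Lemma intT_eq f g : (forall z, normc z = 1 -> f z = g z) -> intT f = intT g.
Proof.
by move=> fg; congr Complex; apply: eq_meanT => t _; rewrite fg// normc_expi.
Qed.

Lemma intT_ae f g : measT f -> measT g -> eqT f g -> intT f = intT g.
Proof.
move=> [f1 f2] [g1 g2] fg; congr Complex; apply: meanT_ae => //;
  by apply: (@filterS _ _ (ae_filter_ringOfSetsType _)) fg => t fg tA; rewrite fg.
Qed.

Lemma L1T_dominated f (k : R -> R) : measT f -> intg k ->
  (forall t, arc R t -> normc (f (expi t)) <= k t) -> L1T f.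
Proof.
move=> mf ik fk; split => //.
- by apply: intg_dominated ik _ => [|t /fk]; [exact: mf.1|];
    exact/le_trans/Re_le_normc.
- by apply: intg_dominated ik _ => [|t /fk]; [exact: mf.2|];
    exact/le_trans/Im_le_normc.
Qed.

Lemma L1T_add f g : L1T f -> L1T g -> L1T (fun z => f z + g z).
Proof.
move=> [mf f1 f2] [mg g1 g2]; split; first exact: measT_add.
- by under eq_fun do rewrite Re_add; exact: intgD.
- by under eq_fun do rewrite Im_add; exact: intgD.
Qed.

Lemma L1T_scale c f : L1T f -> L1T (fun z => c * f z).
Proof.
move=> [mf f1 f2]; split; first exact: measT_mul (measT_cst _) mf.
- under eq_fun do rewrite Re_mul -mulNr.
  by apply: intgD; exact: intgZ.
- under eq_fun do rewrite Im_mul.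
  by apply: intgD; exact: intgZ.
Qed.

Lemma intT_add f g : L1T f -> L1T g ->
  intT (fun z => f z + g z) = intT f + intT g.
Proof.
move=> [mf f1 f2] [mg g1 g2]; apply: complex_eq.
- by rewrite Re_add /= -meanTD//; apply: eq_meanT => t _; rewrite Re_add.
- by rewrite Im_add /= -meanTD//; apply: eq_meanT => t _; rewrite Im_add.
Qed.

Lemma intT_scale c f : L1T f -> intT (fun z => c * f z) = c * intT f.
Proof.
move=> [mf f1 f2]; apply: complex_eq.
- rewrite Re_mul /= -!meanTZ// -mulN1r -meanTZ; last exact: intgZ.
  rewrite -meanTD; [|exact: intgZ|by do 2 apply: intgZ].
  by apply: eq_meanT => t _; rewrite Re_mul mulN1r.
- rewrite Im_mul /= -!meanTZ//.
  rewrite -meanTD; [|exact: intgZ|exact: intgZ].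
  by apply: eq_meanT => t _; rewrite Im_mul.
Qed.

Lemma L1T_conj f : L1T f -> L1T (fun z => conjc (f z)).
Proof.
move=> [mf f1 f2]; split; first exact: measT_conj.
- by move: f1; congr integrable; apply/funext => t; case: (f _).
- have := intgZ (-1) f2; congr integrable; apply/funext => t.
  by case: (f _) => a b /=; rewrite mulN1r.
Qed.

Lemma intT_conj f : L1T f -> intT (fun z => conjc (f z)) = conjc (intT f).
Proof.
move=> [mf f1 f2]; apply: complex_eq.
- by apply: eq_meanT => t _; case: (f _).
- rewrite /= -mulN1r -meanTZ//; apply: eq_meanT => t _; rewrite mulN1r.
  by case: (f _).
Qed.

Lemma intT_cst c : intT (fun=> c) = c.
Proof. by rewrite /intT !meanT_cst; case: c. Qed.

Lemma sqT_ge0 f : 0 <= sqT f.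
Proof. by apply: meanT_ge0 => t; exact: sqr_ge0. Qed.

Lemma sqT_cst c : sqT (fun=> c) = normc c ^+ 2.
Proof. exact: meanT_cst. Qed.

Lemma sqT_eq f g : (forall z, normc z = 1 -> f z = g z) -> sqT f = sqT g.
Proof. by move=> fg; apply: eq_meanT => t _; rewrite fg// normc_expi. Qed.

Lemma L2T_cst c : L2T (fun=> c).
Proof. by split; [exact: measT_cst|exact: intg_cst]. Qed.

(** Applied in both directions with M = 1, this also shows that square
    integrability and the norm do not see null sets. *)
Lemma L2T_dominated_sqT f g (M : R) : measT f -> L2T g -> 0 <= M ->
  aeT (fun z => normc (f z) <= M * normc (g z)) ->
  L2T f /\ sqT f <= M ^+ 2 * sqT g.
Proof.
move=> mf [mg ig] M0 fg.
have := meanT_dominated (measurable_normc_sqr mf) ig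
  (fun=> sqr_ge0 _) (fun=> sqr_ge0 _) (sqr_ge0 M).
case.
  apply: (@filterS _ _ (ae_filter_ringOfSetsType _)) fg => t fg tA.
  rewrite -exprMn ler_pXn2r ?nnegrE ?mulr_ge0 ?normc_ge0//; exact: fg.
by move=> ? ?; split.
Qed.

Lemma L2T_bounded f (M : R) : measT f -> 0 <= M ->
  aeT (fun z => normc (f z) <= M) -> L2T f /\ sqT f <= M ^+ 2.
Proof.
move=> mf M0 fM; have [|i le] := L2T_dominated_sqT mf (L2T_cst 1) M0.
  by apply: aeT_mp fM => z _; rewrite Normc.normc1 mulr1.
by split => //; move: le; rewrite sqT_cst Normc.normc1 expr1n mulr1.
Qed.

Lemma L2T_mul_bounded f g (M : R) : measT f -> L2T g -> 0 <= M ->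
  aeT (fun z => normc (f z) <= M) ->
  L2T (fun z => f z * g z) /\ sqT (fun z => f z * g z) <= M ^+ 2 * sqT g.
Proof.
move=> mf L2g M0 fM; apply: L2T_dominated_sqT => //.
  exact: measT_mul mf L2g.1.
apply: aeT_mp fM => z _ fM; rewrite Normc.normcM ler_wpM2r//; exact: normc_ge0.
Qed.

Lemma L2T_eqT f g : measT g -> eqT f g -> L2T f -> L2T g /\ sqT g = sqT f.
Proof.
move=> mg fg L2f.
have gf : aeT (fun z => normc (g z) <= 1 * normc (f z)).
  by apply: aeT_mp (eqT_aeT fg) => z _ ->; rewrite mul1r.
have fg' : aeT (fun z => normc (f z) <= 1 * normc (g z)).
  by apply: aeT_mp (eqT_aeT fg) => z _ ->; rewrite mul1r.
have [L2g le1] := L2T_dominated_sqT mg L2f ler01 gf.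
have [_ le2] := L2T_dominated_sqT L2f.1 L2g ler01 fg'.
split => //; apply/eqP; rewrite eq_le.
by move: le1 le2; rewrite expr1n !mul1r => -> ->.
Qed.

Lemma L2T_add f g : L2T f -> L2T g -> L2T (fun z => f z + g z).
Proof.
move=> [mf i_f] [mg i_g]; have mfg := measT_add mf mg; split => //.
apply: intg_dominated (measurable_normc_sqr mfg) (intgD (intgZ 2 i_f) (intgZ 2 i_g)) _.
by move=> t _; rewrite ger0_norm ?sqr_ge0//; exact: normc_sqrD_le.
Qed.

Lemma L2T_scale c f : L2T f -> L2T (fun z => c * f z).
Proof.
move=> L2f.
exact: (L2T_mul_bounded (measT_cst c) L2f (normc_ge0 c) (aeT_all (fun _ _ => lexx _))).1.
Qed.

Lemma L2T_opp f : L2T f -> L2T (fun z => - f z).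
Proof.
move=> /(L2T_scale (-1)); congr L2T.
by apply/funext => z; rewrite mulN1r.
Qed.

Lemma L2T_sub f g : L2T f -> L2T g -> L2T (fun z => f z - g z).
Proof. by move=> L2f L2g; apply: L2T_add => //; exact: L2T_opp. Qed.

Lemma L2T_conj f : L2T f -> L2T (fun z => conjc (f z)).
Proof.
move=> [mf i_f]; split; first exact: measT_conj.
by under eq_fun do rewrite normcJ.
Qed.

Lemma sqT_add_le f g : L2T f -> L2T g ->
  sqT (fun z => f z + g z) <= 2 * sqT f + 2 * sqT g.
Proof.
move=> L2f L2g.
have [] := meanT_dominated (M := 1) (measurable_normc_sqr (measT_add L2f.1 L2g.1))
  (intgD (intgZ 2 L2f.2) (intgZ 2 L2g.2)) (fun=> sqr_ge0 _) _ ler01.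
- by move=> t; rewrite addr_ge0// mulr_ge0// sqr_ge0.
- by apply: aeW => t _; rewrite mul1r; exact: normc_sqrD_le.
move=> _; rewrite mul1r meanTD; [|exact: intgZ L2f.2|exact: intgZ L2g.2].
by rewrite !meanTZ//; [exact: L2g.2|exact: L2f.2].
Qed.

Lemma sqT_scale c f : L2T f -> sqT (fun z => c * f z) = normc c ^+ 2 * sqT f.
Proof.
move=> L2f; rewrite /sqT -meanTZ; last exact: L2f.2.
by apply: eq_meanT => t _; rewrite Normc.normcM exprMn.
Qed.

Lemma sqT_sub_le f g h : L2T f -> L2T g -> L2T h ->
  sqT (fun z => f z - h z) <=
  2 * sqT (fun z => f z - g z) + 2 * sqT (fun z => g z - h z).
Proof.
move=> L2f L2g L2h.
apply: le_trans (sqT_add_le (L2T_sub L2f L2g) (L2T_sub L2g L2h)).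
by rewrite le_eqVlt (sqT_eq (g := fun z => f z - g z + (g z - h z))) ?eqxx//
  => z _; rewrite addrA subrK.
Qed.

Lemma sqT_subC f g : sqT (fun z => f z - g z) = sqT (fun z => g z - f z).
Proof. by apply: eq_meanT => t _; rewrite normcB. Qed.

Lemma sqT_eq0 f : L2T f -> sqT f = 0 -> eqT f (fun=> 0).
Proof.
move=> [mf i_f] /(meanT_eq0 (fun=> sqr_ge0 _) i_f).
apply: (@filterS _ _ (ae_filter_ringOfSetsType _)) => t ft tA.
by apply/eqP; rewrite -normc_eq0 -sqrf_eq0 ft.
Qed.

Lemma L1T_mul f g : L2T f -> L2T g -> L1T (fun z => f z * g z).
Proof.
move=> [mf i_f] [mg i_g].
apply: L1T_dominated (measT_mul mf mg) (intgD i_f i_g) _ => t _.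
rewrite Normc.normcM; set x := normc _; set y := normc _.
have := sqr_ge0 (x - y); have := sqr_ge0 x; have := sqr_ge0 y; lra.
Qed.

Lemma L1T_ip f g : L2T f -> L2T g -> L1T (fun z => f z * conjc (g z)).
Proof. by move=> L2f L2g; apply: L1T_mul => //; exact: L2T_conj. Qed.

Lemma innerT_eq f f' g g' : (forall z, normc z = 1 -> f z = f' z) ->
  (forall z, normc z = 1 -> g z = g' z) -> innerT f g = innerT f' g'.
Proof. by move=> ff' gg'; apply: intT_eq => z z1; rewrite ff'// gg'. Qed.

Lemma innerT_ae f f' g g' : measT f -> measT f' -> measT g -> measT g' ->
  eqT f f' -> eqT g g' -> innerT f g = innerT f' g'.
Proof.
move=> mf mf' mg mg' ff' gg'; apply: intT_ae.
- by apply: measT_mul => //; exact: measT_conj.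
- by apply: measT_mul => //; exact: measT_conj.
- by apply: eqT_mp (aeT_and (eqT_aeT ff') (eqT_aeT gg')) => z _ [-> ->].
Qed.

Lemma innerTDl f g h : L2T f -> L2T g -> L2T h ->
  innerT (fun z => f z + g z) h = innerT f h + innerT g h.
Proof.
move=> L2f L2g L2h; rewrite /innerT -intT_add; [|exact: L1T_ip..].
by apply: intT_eq => z _; rewrite mulrDl.
Qed.

Lemma innerTZl c f h : L2T f -> L2T h ->
  innerT (fun z => c * f z) h = c * innerT f h.
Proof.
move=> L2f L2h; rewrite /innerT -intT_scale; last exact: L1T_ip.
by apply: intT_eq => z _; rewrite mulrA.
Qed.

Lemma innerTBl f g h : L2T f -> L2T g -> L2T h ->
  innerT (fun z => f z - g z) h = innerT f h - innerT g h.
Proof.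
move=> L2f L2g L2h; rewrite -mulN1r -innerTZl// -innerTDl//; last exact: L2T_scale.
by apply: innerT_eq => // z _; rewrite mulN1r.
Qed.

Lemma innerTC f g : L2T f -> L2T g -> innerT g f = conjc (innerT f g).
Proof.
move=> L2f L2g; rewrite /innerT -intT_conj; last exact: L1T_ip.
by apply: intT_eq => z _; rewrite rmorphM/= conjcK mulrC.
Qed.

Lemma innerTZr c f h : L2T f -> L2T h ->
  innerT h (fun z => c * f z) = conjc c * innerT h f.
Proof.
move=> L2f L2h; rewrite (innerTC _ L2h) ?innerTZl// ?conjcM; last exact: L2T_scale.
by rewrite -innerTC.
Qed.

Lemma innerTBr f g h : L2T f -> L2T g -> L2T h ->
  innerT h (fun z => f z - g z) = innerT h f - innerT h g.
Proof.
move=> L2f L2g L2h; rewrite (innerTC _ L2h) ?innerTBl// ?conjcB; last exact: L2T_sub.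
by rewrite -!innerTC.
Qed.

Lemma innerT0l h : innerT (fun=> 0) h = 0.
Proof. by rewrite -[RHS]intT_cst; apply: intT_eq => z _; rewrite mul0r. Qed.

Lemma innerT_self f : innerT f f = (sqT f)%:C%C.
Proof.
apply: complex_eq => /=.
- by apply: eq_meanT => t _; rewrite mul_conjc.
- by rewrite -[RHS](meanT_cst (0 : R)); apply: eq_meanT => t _; rewrite mul_conjc.
Qed.

Lemma sqT_sub_scale f g c : L2T f -> L2T g ->
  (sqT (fun z => f z - c * g z))%:C%C =
  (sqT f)%:C%C - conjc c * innerT f g - c * conjc (innerT f g)
    + (normc c ^+ 2)%:C%C * (sqT g)%:C%C :> R[i].
Proof.
move=> L2f L2g; have L2cg := L2T_scale c L2g.
rewrite -innerT_self innerTBl//; last exact: L2T_sub.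
rewrite !innerTBr// !innerTZl// innerTZr// innerTZr// !innerT_self.
rewrite -(innerTC L2f L2g) -mul_conjc; ring.
Qed.

(** The square of f - c g is nonnegative for c = <f, g> / (|g|^2 + 1). The summand
    1 avoids dividing by zero and is harmless, since only continuity is at stake. *)
Lemma innerT_bound f g : L2T f -> L2T g ->
  normc (innerT f g) ^+ 2 <= (sqT g + 1) * sqT f.
Proof.
move=> L2f L2g; set p := innerT f g.
have G0 := sqT_ge0 g; have F0 := sqT_ge0 f.
have G1 : 0 < sqT g + 1 by lra.
pose s := (sqT g + 1)^-1.
have s0 : 0 < s by rewrite invr_gt0.
have sG : s * (sqT g + 1) = 1 by rewrite mulVf// gt_eqF.
have := sqT_ge0 (fun z => f z - (s%:C%C * p) * g z).
rewrite -(ler0c) sqT_sub_scale// -/p.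
have -> : (sqT f)%:C%C - conjc (s%:C%C * p) * p - s%:C%C * p * conjc p +
    (normc (s%:C%C * p) ^+ 2)%:C%C * (sqT g)%:C%C =
    (sqT f - 2 * s * normc p ^+ 2 + s ^+ 2 * normc p ^+ 2 * sqT g)%:C%C.
  rewrite -mul_conjc conjcM conjc_real.
  transitivity ((sqT f)%:C%C - 2 * s%:C%C * (p * conjc p) +
      s%:C%C ^+ 2 * (p * conjc p) * (sqT g)%:C%C); first by ring.
  by rewrite mul_conjc; ring.
rewrite ler0c => h.
set x := normc p ^+ 2 in h *.
have x0 : 0 <= x by exact: sqr_ge0.
have sxG : s ^+ 2 * x * sqT g = s * x - s ^+ 2 * x.
  by rewrite -[in s * x](mulr1 s) -sG; ring.
have sx0 : 0 <= s ^+ 2 * x by rewrite mulr_ge0// sqr_ge0.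
have : s * x <= sqT f by lra.
by rewrite -(ler_pM2l G1) mulrA (mulrC _ s) sG mul1r.
Qed.

End square_integrable.

#[local] Arguments conjc : simpl never.
#[local] Arguments Normc.normc : simpl never.

(** * Fourier coefficients *)

Section fourier.
Variable R : realType.
Implicit Types (f g h : R[i] -> R[i]) (c z w : R[i]) (p q : {poly R[i]}).

Lemma meanT_FTC (h H : R -> R) : continuous h ->
  (forall t : R, is_derive t 1 H (h t)) -> H (2 * pi) = H 0 -> meanT h = 0.
Proof.
move=> ch dH H0.
have cH : continuous H.
  move=> t; apply: differentiable_continuous; apply/derivable1_diffP.
  by have [] := dH t.
have p0 : 0 < 2 * pi :> R by rewrite mulr_gt0 ?pi_gt0.
have := continuous_FTC2 (f := h) (F := H) p0.
rewrite -/(arc R) => FTC; rewrite /meanT /Rintegral FTC.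
- by rewrite H0 subee//= mulr0.
- exact: continuous_subspaceT.
- split.
  + by move=> t _; have [] := dH t.
  + exact: cvg_at_right_filter (cH _).
  + exact: cvg_at_left_filter (cH _).
- by move=> t _; rewrite derive1E; have [_ ->] := dH t.
Qed.

Lemma expi2pi : expi (2 * pi : R) = 1.
Proof. by rewrite /expi mulr2n mulrDl !mul1r -mulr2n cos2pi sin2pi. Qed.

Lemma expi_npi n : expi (n%:R * (2 * pi) : R) = 1.
Proof. by rewrite -expi_exp expi2pi expr1n. Qed.

(** The primitives of cos (n t) and sin (n t) are 2 pi-periodic. *)
Lemma intT_exp n : (0 < n)%N -> intT (fun z : R[i] => z ^+ n) = 0.
Proof.
move=> n0; have nR : (n%:R : R) != 0 by rewrite pnatr_eq0 -lt0n.
have dn (t : R) : is_derive t 1 (fun s : R => n%:R * s) n%:R.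
  have := @is_deriveZ _ _ _ id n%:R t 1 1 _.
  by move/(_ (is_derive_id _ _)); rewrite /GRing.scale/= mulr1.
have cont_n : continuous (fun s : R => n%:R * s).
  by move=> s; apply: cvgM; [exact: cvg_cst|exact: cvg_id].
apply: complex_eq.
- rewrite /= (eq_meanT (k := fun t => cos (n%:R * t))); last first.
    by move=> t _; rewrite expi_exp.
  apply: (meanT_FTC (H := fun t => n%:R^-1 * sin (n%:R * t))).
  + by move=> t; apply: continuous_comp; [exact: cont_n|exact: continuous_cos].
  + move=> t; have D := is_derive1_comp (is_derive_sin (n%:R * t)) (dn t).
    have := @is_deriveZ _ _ _ _ n%:R^-1 t 1 _ D; rewrite /GRing.scale/=.
    by rewrite mulrCA mulVf// mulr1.
  + congr (_ * _); have := expi_npi n; rewrite /expi => -[_ ->].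
    by rewrite mulr0 sin0.
- rewrite /= (eq_meanT (k := fun t => sin (n%:R * t))); last first.
    by move=> t _; rewrite expi_exp.
  apply: (meanT_FTC (H := fun t => - (n%:R^-1 * cos (n%:R * t)))).
  + by move=> t; apply: continuous_comp; [exact: cont_n|exact: continuous_sin].
  + move=> t; have D := is_derive1_comp (is_derive_cos (n%:R * t)) (dn t).
    have := @is_deriveN _ _ _ _ _ _ _ (@is_deriveZ _ _ _ _ n%:R^-1 t 1 _ D); rewrite /GRing.scale/=.
    by rewrite mulNr mulrN opprK mulrCA mulVf// mulr1.
  + congr (- (_ * _)); have := expi_npi n; rewrite /expi => -[-> _].
    by rewrite mulr0 cos0.
Qed.

Lemma L2T_exp n : L2T (fun z : R[i] => z ^+ n).
Proof.
apply: (L2T_bounded (M := 1) (measT_exp n (@measT_id R)) ler01 _).1.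
by apply: aeT_all => z z1; rewrite normcX z1 expr1n.
Qed.

Lemma L2T_horner p : L2T (fun z => p.[z]).
Proof.
under eq_fun do rewrite horner_coef.
elim: (size p) => [|n IH]; first by under eq_fun do rewrite big_ord0; exact: L2T_cst.
under eq_fun do rewrite big_ord_recr/=.
by apply: L2T_add => //; apply: L2T_scale; exact: L2T_exp.
Qed.

Lemma L2T_psum (a : nat -> R[i]) N : L2T (fun z => \sum_(k < N) a k * z ^+ k).
Proof.
elim: N => [|n IH]; first by under eq_fun do rewrite big_ord0; exact: L2T_cst.
under eq_fun do rewrite big_ord_recr/=.
by apply: L2T_add => //; apply: L2T_scale; exact: L2T_exp.
Qed.

Lemma sqT_exp n : sqT (fun z : R[i] => z ^+ n) = 1.
Proof.
rewrite /sqT (eq_meanT (k := fun=> 1)) ?meanT_cst// => t _.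
by rewrite normcX normc_expi !expr1n.
Qed.

(** On the circle conj z is the inverse of z, so the product of the two powers is
    a power of z or the conjugate of one. *)
Lemma innerT_exp m n : innerT (fun z : R[i] => z ^+ m) (fun z => z ^+ n) = (m == n)%:R.
Proof.
wlog mn : m n / (n <= m)%N => [th|].
  case/orP: (leq_total n m) => [/th//|/th nm].
  by rewrite innerTC ?nm; [rewrite eq_sym conjc_nat|exact: L2T_exp|exact: L2T_exp].
have [->|mn'] := eqVneq m n.
  by rewrite innerT_self sqT_exp.
rewrite -[RHS](intT_exp (n := m - n)); last by rewrite subn_gt0 ltn_neqAle eq_sym mn' mn.
apply: intT_eq => z z1; rewrite conjcX -{1}(subnK mn) exprD -mulrA -exprMn.
by rewrite unit_conjc// expr1n mulr1.
Qed.

Definition fcoef f n : R[i] := innerT f (fun z => z ^+ n).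

Lemma fcoef_psum (a : nat -> R[i]) N n :
  fcoef (fun z => \sum_(k < N) a k * z ^+ k) n = if (n < N)%N then a n else 0.
Proof.
rewrite /fcoef; elim: N => [|N IH].
  by rewrite (innerT_eq (f' := fun=> 0) (g' := fun z => z ^+ n))// ?innerT0l// => z _;
     rewrite big_ord0.
rewrite (innerT_eq (f' := fun z => \sum_(k < N) a k * z ^+ k + a N * z ^+ N)
  (g' := fun z => z ^+ n))//; last by move=> z _; rewrite big_ord_recr.
rewrite innerTDl; [|exact: L2T_psum|by apply: L2T_scale; exact: L2T_exp|exact: L2T_exp].
rewrite IH innerTZl; [|exact: L2T_exp|exact: L2T_exp].
rewrite innerT_exp ltnS [(n <= N)%N]leq_eqVlt [n == N]eq_sym.
have [->|_] := eqVneq N n; first by rewrite ltnn/= mulr1 add0r.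
by rewrite mulr0 addr0.
Qed.

Lemma fcoef_bound f n : L2T f -> normc (fcoef f n) ^+ 2 <= 2 * sqT f.
Proof.
move=> L2f; apply: le_trans (innerT_bound L2f (L2T_exp n)) _.
by rewrite ler_wpM2r ?sqT_ge0// sqT_exp.
Qed.

Lemma fcoefB f g n : L2T f -> L2T g ->
  fcoef (fun z => f z - g z) n = fcoef f n - fcoef g n.
Proof. by move=> L2f L2g; apply: innerTBl => //; exact: L2T_exp. Qed.

(** Subtracting one more term of the Fourier series removes exactly the square of
    its coefficient, the term being orthogonal to the earlier ones. *)
Lemma bessel_eq f N : L2T f ->
  sqT (fun z => f z - \sum_(k < N) fcoef f k * z ^+ k) =
  sqT f - \sum_(k < N) normc (fcoef f k) ^+ 2.
Proof.
move=> L2f; elim: N => [|N IH].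
  rewrite big_ord0 subr0; apply: sqT_eq => z _; by rewrite big_ord0 subr0.
pose g z := f z - \sum_(k < N) fcoef f k * z ^+ k.
have L2g : L2T g by apply: L2T_sub => //; exact: L2T_psum.
rewrite (sqT_eq (g := fun z => g z - fcoef f N * z ^+ N)); last first.
  by move=> z _; rewrite /g big_ord_recr/= opprD addrA.
apply: complexI; rewrite sqT_sub_scale//; last exact: L2T_exp.
rewrite -/(fcoef g N) fcoefB//; last exact: L2T_psum.
rewrite fcoef_psum ltnn subr0 sqT_exp IH big_ord_recr/=.
by rewrite (mulrC (conjc _)) !mul_conjc; ring.
Qed.

Lemma bessel f N : L2T f -> \sum_(k < N) normc (fcoef f k) ^+ 2 <= sqT f.
Proof. by move=> L2f; rewrite -subr_ge0 -bessel_eq// sqT_ge0. Qed.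

Lemma sqT_psum (a : nat -> R[i]) N :
  sqT (fun z => \sum_(k < N) a k * z ^+ k) = \sum_(k < N) normc (a k) ^+ 2.
Proof.
have := bessel_eq N (L2T_psum a N).
rewrite (sqT_eq (g := fun=> 0)); last first.
  move=> z _; under [X in _ - X]eq_bigr do rewrite fcoef_psum ltn_ord.
  by rewrite subrr.
rewrite sqT_cst Normc.normc0 expr0n/=.
under [X in _ - X]eq_bigr do rewrite fcoef_psum ltn_ord.
by move/esym/eqP; rewrite subr_eq0 => /eqP.
Qed.

End fourier.

(** * Szego kernels and the closure of the polynomials *)

Section hardy.
Variable R : realType.
Implicit Types (f g h : R[i] -> R[i]) (c z w : R[i]) (p q : {poly R[i]}).

Lemma sum_geometric (x : R[i]) N : x != 1 ->
  \sum_(k < N) x ^+ k = (1 - x ^+ N) / (1 - x).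
Proof.
move=> x1; have nz : 1 - x != 0 by rewrite subr_eq0 eq_sym.
apply: (mulIf nz); rewrite divfK// -(opprB (x ^+ N)) subrX1 -mulNr opprB.
exact: mulrC.
Qed.

Lemma normc_1B_ge z : 1 - normc z <= normc (1 - z).
Proof. by have := normc_subr 1 z; rewrite Normc.normc1. Qed.

Lemma null_expr (r : R) : 0 <= r < 1 -> r ^+ n @[n --> \oo] --> 0.
Proof. by move=> /andP[r0 r1]; apply: cvg_expr; rewrite ger0_norm. Qed.

(** The reproducing kernel of H^2 at z. *)
Definition szego z w : R[i] := (1 - conjc z * w)^-1.

Lemma szego_den z w : disk z -> normc w = 1 -> 1 - normc z <= normc (1 - conjc z * w).
Proof.
by move=> zD w1; have := normc_1B_ge (conjc z * w); rewrite Normc.normcM w1 mulr1 normcJ.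
Qed.

Lemma szego_den_neq0 z w : disk z -> normc w = 1 -> 1 - conjc z * w != 0.
Proof.
move=> zD w1; rewrite -normc_gt0; apply: lt_le_trans (szego_den zD w1).
by rewrite subr_gt0.
Qed.

Lemma measT_szego z : measT (szego z).
Proof.
apply: measT_inv; apply: measT_sub (measT_cst 1) _.
by apply: measT_mul (measT_cst _) _; exact: measT_id.
Qed.

Lemma szego_bound z w : disk z -> normc w = 1 -> normc (szego z w) <= (1 - normc z)^-1.
Proof.
move=> zD w1; rewrite Normc.normcV lef_pV2 ?szego_den// posrE ?subr_gt0//.
by rewrite normc_gt0 szego_den_neq0.
Qed.

Lemma disk_inv_ge0 z : disk z -> 0 <= (1 - normc z)^-1.
Proof. by move=> zD; rewrite invr_ge0 subr_ge0 ltW. Qed.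

Lemma L2T_szego z : disk z -> L2T (szego z).
Proof.
move=> zD; apply: (L2T_bounded (measT_szego z) (disk_inv_ge0 zD) _).1.
by apply: aeT_all => w w1; exact: szego_bound.
Qed.

(** The remainder of the geometric series is uniformly small on the circle. *)
Lemma szego_psum z w N : disk z -> normc w = 1 ->
  normc (szego z w - \sum_(k < N) conjc z ^+ k * w ^+ k) <=
  normc z ^+ N * (1 - normc z)^-1.
Proof.
move=> zD w1; have nz := szego_den_neq0 zD w1.
under eq_bigr do rewrite -exprMn.
rewrite sum_geometric; last by rewrite -subr_eq0 -oppr_eq0 opprB.
have -> : szego z w - (1 - (conjc z * w) ^+ N) / (1 - conjc z * w) =
    (conjc z * w) ^+ N * szego z w by rewrite /szego; field.
rewrite Normc.normcM normcX Normc.normcM normcJ w1 mulr1.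
by rewrite ler_wpM2l ?szego_bound// exprn_ge0// normc_ge0.
Qed.

Lemma sqT_szego_psum z N : disk z ->
  sqT (fun w => szego z w - \sum_(k < N) conjc z ^+ k * w ^+ k) <=
  (normc z ^+ N * (1 - normc z)^-1) ^+ 2.
Proof.
move=> zD; apply: (L2T_bounded _ _ _).2.
- by apply: measT_sub (measT_szego z) _; exact: (L2T_psum _ _).1.
- by rewrite mulr_ge0 ?exprn_ge0 ?normc_ge0 ?disk_inv_ge0.
- by apply: aeT_all => w w1; exact: szego_psum.
Qed.

(** For f in H^2 this is the value at z of the extension of f to the disk, and for
    f in L^2 that of the extension of the projection of f on H^2. *)
Definition hev f z : R[i] := innerT f (szego z).

(** The partial sums of the Taylor series are inner products with those of the
    geometric series of the kernel. *)
Lemma hev_psum f z N : L2T f -> disk z ->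
  normc (hev f z - \sum_(k < N) fcoef f k * z ^+ k) ^+ 2 <=
  (sqT f + 1) * (normc z ^+ N * (1 - normc z)^-1) ^+ 2.
Proof.
move=> L2f zD; have L2S := L2T_psum (fun k => conjc z ^+ k) N.
have L2k := L2T_szego zD.
have -> : \sum_(k < N) fcoef f k * z ^+ k =
    innerT f (fun w => \sum_(k < N) conjc z ^+ k * w ^+ k).
  rewrite innerTC// -/(innerT _ _).
  elim: N {L2S} => [|N IH].
    rewrite big_ord0 (innerT_eq (f' := fun=> 0) (g' := f))//.
      by rewrite innerT0l conjc0.
    by move=> w _; rewrite big_ord0.
  rewrite (innerT_eq (f' := fun w => \sum_(k < N) conjc z ^+ k * w ^+ k +
    conjc z ^+ N * w ^+ N) (g' := f))//; last by move=> w _; rewrite big_ord_recr.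
  rewrite innerTDl//; [|exact: L2T_psum|by apply: L2T_scale; exact: L2T_exp].
  rewrite conjcD -IH big_ord_recr/=; congr (_ + _).
  rewrite innerTZl//; last exact: L2T_exp.
  rewrite conjcM -innerTC//; last exact: L2T_exp.
  by rewrite -conjcX conjcK mulrC.
rewrite /hev -innerTBr// innerTC//; last exact: L2T_sub.
rewrite normcJ; apply: le_trans (innerT_bound _ L2f) _; first exact: L2T_sub.
by rewrite ler_wpM2l ?sqT_szego_psum// addr_ge0// sqT_ge0.
Qed.

Lemma null_disk (C : R) z : disk z ->
  (fun N => C * (normc z ^+ N * (1 - normc z)^-1) ^+ 2) @ \oo --> (0 : R).
Proof.
move=> zD; have h : (fun N => normc z ^+ N * (1 - normc z)^-1) @ \oo --> (0 : R).
  rewrite -(mul0r (1 - normc z)^-1); apply: cvgMl.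
  by apply: null_expr; rewrite normc_ge0.
rewrite -(mulr0 C); apply: cvgMr; rewrite -(mulr0 (0 : R)).
exact: cvgM.
Qed.

Lemma null_sqr (u : nat -> R) : (forall n, 0 <= u n) ->
  (fun n => u n ^+ 2) @ \oo --> (0 : R) -> u @ \oo --> (0 : R).
Proof.
move=> u0 h; have -> : u = (fun n => Num.sqrt (u n ^+ 2)).
  by apply/funext => n /=; rewrite sqrtr_sqr ger0_norm.
rewrite -[X in _ --> X](sqrtr0 R); apply: continuous_cvg h.
exact: sqrt_continuous.
Qed.

Lemma null_dominated (u v : nat -> R) : (forall n, 0 <= u n <= v n) ->
  v @ \oo --> (0 : R) -> u @ \oo --> (0 : R).
Proof.
move=> uv; apply: cvg_dominated => n; have /andP[? ?] := uv n.
by rewrite subr0 ger0_norm.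
Qed.

Lemma hev_series f z : L2T f -> disk z ->
  (fun N => normc (\sum_(k < N) fcoef f k * z ^+ k - hev f z)) @ \oo --> (0 : R).
Proof.
move=> L2f zD; apply: null_sqr; first by move=> n; exact: normc_ge0.
apply: null_dominated (null_disk (sqT f + 1) zD) => N.
by rewrite sqr_ge0 normcB hev_psum.
Qed.

Lemma normc_null_eq (z : R[i]) (u : nat -> R) : (forall n, normc z <= u n) ->
  u @ \oo --> (0 : R) -> z = 0.
Proof.
move=> zu u0; apply: Normc.eq0_normc; apply/eqP; rewrite eq_le normc_ge0 andbT.
apply/ler_addgt0Pl => e e0.
have /cvgrPdist_le/(_ e e0) [N _ h] := u0.
have := h N (leqnn N); rewrite sub0r normrN => uN; rewrite ?addr0 ?add0r.
by apply: le_trans (zu N) _; apply: le_trans uN; exact: ler_norm.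
Qed.

Lemma series_unique (S : nat -> R[i]) z w :
  (fun N => normc (S N - z)) @ \oo --> (0 : R) ->
  (fun N => normc (S N - w)) @ \oo --> (0 : R) -> z = w.
Proof.
move=> Sz Sw; apply/eqP; rewrite -subr_eq0; apply/eqP.
apply: (normc_null_eq (u := fun N => normc (S N - w) + normc (S N - z))).
  move=> N; rewrite (normcB (S N) z).
  by have -> : z - w = S N - w + (z - S N); [ring|exact: le_normcD].
by rewrite -(addr0 (0 : R)); exact: cvgD.
Qed.

Lemma fcoef_horner p n : fcoef (fun z => p.[z]) n = p`_n.
Proof.
rewrite /fcoef; under [X in innerT X _]eq_fun do rewrite horner_coef.
rewrite -/(fcoef _ _) fcoef_psum; case: ltnP => // h; by rewrite nth_default.
Qed.

Lemma hev_horner p z : disk z -> hev (fun w => p.[w]) z = p.[z].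
Proof.
move=> zD; apply/esym.
have := hev_series (L2T_horner p) zD; apply: series_unique.
apply: cvg_near_cst; near=> N.
have pN : (size p <= N)%N by near: N; exact: nbhs_infty_ge.
under eq_bigr do rewrite fcoef_horner.
rewrite (horner_coef_wide _ pN) subrr; exact: Normc.normc0.
Unshelve. all: by end_near. Qed.

(** H^2 is identified with this closure below; membership is then a matter of
    approximation, and no power series has to be multiplied or composed. *)
Definition polycl f : Prop := L2T f /\
  forall e : R, 0 < e -> exists p, sqT (fun z => f z - p.[z]) < e.

Lemma polycl_horner p : polycl (fun z => p.[z]).
Proof.
split; first exact: L2T_horner.
move=> e e0; exists p; rewrite (sqT_eq (g := fun=> 0)) => [|z _]; last exact: subrr.
by rewrite sqT_cst Normc.normc0 expr0n.
Qed.

Lemma polycl_closed f : L2T f ->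
  (forall e : R, 0 < e -> exists2 g, polycl g & sqT (fun z => f z - g z) < e) ->
  polycl f.
Proof.
move=> L2f fe; split => // e e0.
have e40 : 0 < e / 4 by rewrite divr_gt0.
have [g [L2g gp] fg] := fe _ e40; have [p gpe] := gp _ e40.
exists p; apply: le_lt_trans (sqT_sub_le L2f L2g (L2T_horner p)) _; lra.
Qed.

Lemma polycl_psum (a : nat -> R[i]) N : polycl (fun z => \sum_(k < N) a k * z ^+ k).
Proof.
have -> : (fun z => \sum_(k < N) a k * z ^+ k) = (fun z => (\poly_(k < N) a k).[z]).
  by apply/funext => z; rewrite horner_poly.
exact: polycl_horner.
Qed.

Lemma polycl_eqT f g : measT g -> eqT f g -> polycl f -> polycl g.
Proof.
move=> mg fg [L2f fe]; have [L2g _] := L2T_eqT mg fg L2f.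
split => // e /fe[p pe]; exists p.
have L2p := L2T_horner p.
rewrite (L2T_eqT (f := fun z => f z - p.[z]) _ _ _).2//.
- exact: measT_sub mg L2p.1.
- by apply: eqT_mp (eqT_aeT fg) => z _ ->.
- exact: L2T_sub.
Qed.

Lemma polycl_add f g : polycl f -> polycl g -> polycl (fun z => f z + g z).
Proof.
move=> [L2f fe] [L2g ge]; split; first exact: L2T_add.
move=> e e0; have e40 : 0 < e / 4 by rewrite divr_gt0.
have [p pe] := fe _ e40; have [q qe] := ge _ e40; exists (p + q).
rewrite (sqT_eq (g := fun z => (f z - p.[z]) + (g z - q.[z]))); last first.
  by move=> z _; rewrite hornerD; ring.
apply: le_lt_trans (sqT_add_le _ _) _; [| |lra];
  by apply: L2T_sub => //; exact: L2T_horner.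
Qed.

Lemma polycl_scale c f : polycl f -> polycl (fun z => c * f z).
Proof.
move=> [L2f fe]; split; first exact: L2T_scale.
move=> e e0; have c0 : 0 < normc c ^+ 2 + 1 by rewrite ltr_wpDl// sqr_ge0.
have [p pe] := fe (e / (normc c ^+ 2 + 1)) (divr_gt0 e0 c0); exists (c *: p).
rewrite (sqT_eq (g := fun z => c * (f z - p.[z]))); last first.
  by move=> z _; rewrite hornerZ; ring.
rewrite sqT_scale; last by apply: L2T_sub => //; exact: L2T_horner.
move: pe; rewrite ltr_pdivlMr//; apply: le_lt_trans.
by rewrite mulrC ler_wpM2l ?sqT_ge0// lerDl.
Qed.

Lemma polycl_szego z : disk z -> polycl (szego z).
Proof.
move=> zD; apply: polycl_closed (L2T_szego zD) _ => e e0.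
have /cvgrPdist_lt/(_ e e0)[N _ h] := null_disk 1 zD.
exists (fun w => \sum_(k < N) conjc z ^+ k * w ^+ k); first exact: polycl_psum.
apply: le_lt_trans (sqT_szego_psum _ zD) _.
have := h N (leqnn N); rewrite sub0r normrN mul1r; apply: le_lt_trans.
exact: ler_norm.
Qed.

End hardy.

(** * Boundary functions are limits of polynomials *)

Section hardy_boundary.
Variable R : realType.
Implicit Types (f g h F : R[i] -> R[i]) (c z w : R[i]) (p q : {poly R[i]}).

Lemma normcR_ge0 (r : R) z : 0 <= r -> normc (r%:C%C * z) = r * normc z.
Proof. by move=> r0; rewrite Normc.normcM normcR ger0_norm. Qed.

Lemma disk_circle (r : R) w : 0 <= r < 1 -> normc w = 1 -> disk (r%:C%C * w).
Proof. by move=> /andP[r0 r1] w1; rewrite /disk normcR_ge0// w1 mulr1. Qed.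

Lemma coef_bounded (a : nat -> R[i]) :
  cvgn (series (fun n => normc (a n) ^+ 2)) ->
  exists2 A : R, 0 <= A & forall n, normc (a n) <= A.
Proof.
move=> /cvg_series_cvg_0 h0.
have [M [_ hM]] : bounded_fun (fun n => normc (a n) ^+ 2).
  by apply: cvg_seq_bounded; apply/cvg_ex; exists 0.
have := hM (`|M| + 1); rewrite ltr_pwDr ?ler_norm// => /(_ isT) h.
exists (`|M| + 2) => [|n]; first by rewrite addr_ge0.
have := h n I; rewrite /= ger0_norm ?sqr_ge0// => an.
have n0 := normc_ge0 (a n); have M0 := normr_ge0 M; nra.
Qed.

(** Telescoping: (1 - r) times the modulus of a block of terms is at most
    A (r^N - r^(N + M)); the limit in M gives the bound. *)
Lemma power_tail (a : nat -> R[i]) (A : R) (r : R) z w N : 0 <= r < 1 -> 0 <= A ->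
  (forall n, normc (a n) <= A) -> normc z = r ->
  (fun N => normc (\sum_(n < N) a n * z ^+ n - w)) @ \oo --> (0 : R) ->
  normc (w - \sum_(n < N) a n * z ^+ n) <= A * (r ^+ N * (1 - r)^-1).
Proof.
move=> /andP[r0 r1] A0 aA zr Sw; have r1' : 0 < 1 - r by rewrite subr_gt0.
pose S N := \sum_(n < N) a n * z ^+ n.
have step M : (1 - r) * normc (S (N + M)%N - S N) <= A * (r ^+ N - r ^+ (N + M)).
  elim: M => [|M IH]; first by rewrite addn0 !subrr Normc.normc0 !mulr0.
  have -> : S (N + M.+1)%N - S N = (S (N + M)%N - S N) + a (N + M)%N * z ^+ (N + M).
    by rewrite /S addnS big_ord_recr/=; ring.
  have t : normc (a (N + M)%N * z ^+ (N + M)) <= A * r ^+ (N + M).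
    by rewrite Normc.normcM normcX zr ler_wpM2r// exprn_ge0.
  have := ler_wpM2l (ltW r1') (lerD (lexx (normc (S (N + M)%N - S N))) t).
  have := ler_wpM2l (ltW r1') (le_normcD (S (N + M)%N - S N) (a (N + M)%N * z ^+ (N + M))).
  by rewrite addnS exprS; lra.
rewrite mulrA ler_pdivlMr// mulrC; apply/ler_addgt0Pl => e e0.
have /cvgrPdist_le/(_ e e0)[M _ hM] := Sw.
have := hM (N + M)%N (leq_addl _ _); rewrite sub0r normrN ger0_norm ?normc_ge0// => SM.
have tri : normc (w - S N) <= normc (S (N + M)%N - w) + normc (S (N + M)%N - S N).
  rewrite (normcB (S (N + M)%N) w).
  have -> : w - S N = (w - S (N + M)%N) + (S (N + M)%N - S N) by ring.
  exact: le_normcD.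
have := step M; have rM : 0 <= A * r ^+ (N + M) by rewrite mulr_ge0// exprn_ge0.
have := ler_wpM2l (ltW r1') tri.
have : (1 - r) * normc (S (N + M)%N - w) <= e.
  apply: le_trans SM; rewrite ler_piMl ?normc_ge0//; lra.
rewrite -/(S N); lra.
Qed.

Lemma null_small (u : nat -> R) (e : R) m : 0 < e -> u @ \oo --> (0 : R) ->
  exists2 n, (m <= n)%N & u n < e.
Proof.
move=> e0 /cvgrPdist_lt/(_ e e0)[n _ h]; exists (n + m)%N; first exact: leq_addl.
have := h (n + m)%N (leq_addr _ _); rewrite sub0r normrN; apply: le_lt_trans.
exact: ler_norm.
Qed.

Lemma null_geometric (C r : R) : 0 <= r < 1 ->
  (fun N => C * (r ^+ N * (1 - r)^-1) ^+ 2) @ \oo --> (0 : R).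
Proof.
move=> /andP[r0 r1]; have E : normc r%:C%C = r by rewrite normcR ger0_norm.
by have := @null_disk R C r%:C%C; rewrite /disk E => /(_ r1).
Qed.

(** On the circle of radius r < 1 the Taylor series converges uniformly, so the
    dilate is a limit of polynomials and its Fourier coefficients are known. *)
Lemma dilate_psum F (a : nat -> R[i]) (A r : R) : 0 <= r < 1 -> 0 <= A ->
  (forall n, normc (a n) <= A) ->
  (forall z, disk z ->
     (fun N => normc (\sum_(n < N) a n * z ^+ n - F z)) @ \oo --> (0 : R)) ->
  let Fr := fun w => F (r%:C%C * w) in
  [/\ L2T Fr, polycl Fr & forall n, fcoef Fr n = a n * r%:C%C ^+ n].
Proof.
move=> r01 A0 aA aF Fr.
pose S N w := \sum_(n < N) (a n * r%:C%C ^+ n) * w ^+ n.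
have SE N w : S N w = \sum_(n < N) a n * (r%:C%C * w) ^+ n.
  by apply: eq_bigr => n _; rewrite exprMn mulrA.
have L2S N : L2T (S N) by exact: (L2T_psum (fun n => a n * r%:C%C ^+ n) N).
have mFr : measT Fr.
  apply: (measT_cvg (h := S)) => [n|w w1]; first exact: (L2S n).1.
  under eq_fun do rewrite SE; apply: aF; exact: disk_circle.
have r0 : 0 <= r by case/andP: r01.
have dist N : aeT (fun w => normc (Fr w - S N w) <= A * (r ^+ N * (1 - r)^-1)).
  apply: aeT_all => w w1; rewrite SE; apply: power_tail => //.
    by rewrite normcR_ge0// w1 mulr1.
  by apply: aF; exact: disk_circle.
have bd0 N : 0 <= A * (r ^+ N * (1 - r)^-1).
  rewrite !mulr_ge0// ?exprn_ge0// invr_ge0 subr_ge0 ltW//.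
  by case/andP: r01.
have dist2 N := L2T_bounded (measT_sub mFr (L2S N).1) (bd0 N) (dist N).
have L2Fr : L2T Fr.
  have -> : Fr = fun w => (Fr w - S 0 w) + S 0 w.
    by apply/funext => w; rewrite subrK.
  exact: L2T_add (dist2 0).1 (L2S 0).
have null : (fun N => (A * (r ^+ N * (1 - r)^-1)) ^+ 2) @ \oo --> (0 : R).
  by under eq_fun do rewrite exprMn; exact: null_geometric.
split => //.
- apply: polycl_closed => // e e0.
  have [N _ hN] := null_small 0 e0 null.
  exists (S N); first exact: (polycl_psum (fun n => a n * r%:C%C ^+ n) N).
  exact: le_lt_trans (dist2 N).2 hN.
- move=> n; apply/eqP; rewrite -subr_eq0; apply/eqP.
  apply: Normc.eq0_normc; apply/eqP; rewrite -sqrf_eq0; apply/eqP.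
  apply/eqP; rewrite eq_le sqr_ge0 andbT; apply/ler_addgt0Pl => e e0.
  have e20 : 0 < e / 2 by rewrite divr_gt0.
  have [N nN hN] := null_small n.+1 e20 null; rewrite addr0.
  have -> : a n * r%:C%C ^+ n = fcoef (S N) n.
    by rewrite (fcoef_psum (fun n => a n * r%:C%C ^+ n)) nN.
  rewrite -fcoefB//; apply: le_trans (fcoef_bound _ (dist2 _).1) _.
  have := (dist2 N).2; lra.
Qed.

Lemma sqT_normT f : sqT f = normT f ^+ 2.
Proof. by rewrite sqr_sqrtr// sqT_ge0. Qed.

Lemma near_at_left1 : \forall r \near (1 : R)^'-, 0 <= r < 1.
Proof.
near=> r; apply/andP; split; last by near: r; exact: nbhs_left_lt.
by near: r; apply: nbhs_left_ge; exact: ltr01.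
Unshelve. all: by end_near. Qed.

(** The dilates tend to f in L^2, so their Fourier coefficients a_n r^n tend both to
    those of f and to a_n. Hence the Taylor series of F is that of hev f. *)
Lemma hardy_boundary_hev F f : hardy_boundary F f ->
  polycl f /\ forall z, disk z -> F z = hev f z.
Proof.
move=> [[a [/coef_bounded[A A0 aA] aF]] L2f lim].
have dil r r01 := dilate_psum (r := r) r01 A0 aA aF.
have lim2 (e : R) : 0 < e -> \forall r \near (1 : R)^'-,
    0 <= r < 1 /\ sqT (fun z => F (r%:C%C * z) - f z) < e.
  move=> e0; have se0 : 0 < Num.sqrt e by rewrite sqrtr_gt0.
  move/cvgrPdist_lt/(_ _ se0): lim => lim; near=> r; split.
    by near: r; exact: near_at_left1.
  rewrite sqT_normT -(sqr_sqrtr (ltW e0)) ltr_pXn2r ?nnegrE ?sqrtr_ge0//.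
  have := near lim r; rewrite sub0r normrN ger0_norm ?sqrtr_ge0//; exact.
have clf : polycl f.
  apply: polycl_closed => // e e0.
  have [r [r01 h]] := filter_ex (lim2 e e0); have [_ clr _] := dil _ r01.
  by exists (fun z => F (r%:C%C * z)) => //; rewrite sqT_subC.
split => // z zD.
have coefE n : fcoef f n = a n.
  apply/eqP; rewrite -subr_eq0; apply/eqP; apply: Normc.eq0_normc.
  apply/eqP; rewrite eq_le normc_ge0 andbT; apply/ler_addgt0Pl => e e0.
  rewrite addr0.
  have e20 : 0 < (e / 2) ^+ 2 / 2 by rewrite divr_gt0// exprn_gt0// divr_gt0.
  have rn : (fun r : R => A * (1 - r ^+ n)) r @[r --> (1 : R)^'-] --> (0 : R).
    rewrite -(mulr0 A); apply: cvgMr.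
    rewrite -(subrr (1 : R)); apply: cvgB; first exact: cvg_cst.
    rewrite -[X in _ --> X](expr1n R n); apply: cvg_at_left_filter.
    exact: exprn_continuous.
  have e2 : 0 < e / 2 by rewrite divr_gt0.
  move/cvgrPdist_lt/(_ _ e2): rn => rn.
  have [r [[r01 h] hr]] := filter_ex (filterI (lim2 _ e20) rn).
  have [L2r _ cr] := dil _ r01; have r0 : 0 <= r by case/andP: r01.
  have -> : fcoef f n - a n = (fcoef f n - a n * r%:C%C ^+ n) - a n * (1 - r ^+ n)%:C%C.
    by rewrite rmorphB rmorphXn rmorph1; ring.
  apply: le_trans (le_normcD _ _) _; rewrite normcN.
  have d1 : normc (fcoef f n - a n * r%:C%C ^+ n) <= e / 2.
    rewrite -(ler_pXn2r (n := 2)) ?nnegrE ?normc_ge0 ?(ltW e2)//.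
    rewrite -cr -fcoefB//; apply: le_trans (fcoef_bound _ (L2T_sub L2f L2r)) _.
    by rewrite sqT_subC; lra.
  have d2 : normc (a n * (1 - r ^+ n)%:C%C) <= e / 2.
    rewrite Normc.normcM normcR.
    have rn1 : r ^+ n <= 1 by rewrite exprn_ile1// ltW//; case/andP: r01.
    rewrite ger0_norm ?subr_ge0//; apply: le_trans (ltW hr).
    rewrite sub0r normrN; apply: le_trans (ler_norm _).
    by rewrite ler_wpM2r// subr_ge0.
  by lra.
apply: (series_unique (aF z zD)).
by have := hev_series L2f zD; under eq_fun do under eq_bigr do rewrite coefE.
Unshelve. all: by end_near. Qed.

End hardy_boundary.

(** * Limits of polynomials are boundary functions *)

Section hardy_space.
Variable R : realType.
Implicit Types (f g h F : R[i] -> R[i]) (c z w : R[i]) (p q : {poly R[i]}).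

Lemma hevB f g z : L2T f -> L2T g -> disk z ->
  hev (fun w => f w - g w) z = hev f z - hev g z.
Proof. by move=> L2f L2g zD; apply: innerTBl => //; exact: L2T_szego. Qed.

Lemma fcoef_seq_bounded f n : L2T f -> normc (fcoef f n) <= Num.sqrt (2 * sqT f).
Proof.
move=> L2f; rewrite -(ler_pXn2r (n := 2)) ?nnegrE ?normc_ge0 ?sqrtr_ge0//.
by rewrite [leRHS]sqr_sqrtr; [exact: fcoef_bound|rewrite mulr_ge0// sqT_ge0].
Qed.

(** Dilation decreases every Fourier coefficient, so the partial sums obey the
    Bessel inequality; the factor 2 comes from the passage to the limit. *)
Lemma sqT_dilate f (r : R) : L2T f -> 0 <= r < 1 ->
  L2T (fun w => hev f (r%:C%C * w)) /\
  sqT (fun w => hev f (r%:C%C * w)) <= 2 * sqT f.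
Proof.
move=> L2f r01; have /andP[r0 r1] := r01.
have aF z : disk z ->
    (fun N => normc (\sum_(n < N) fcoef f n * z ^+ n - hev f z)) @ \oo --> (0 : R).
  by move=> zD; exact: hev_series.
have [L2r _ cr] := dilate_psum r01 (sqrtr_ge0 _) (fun n => fcoef_seq_bounded n L2f) aF.
split => //.
pose S N w := \sum_(n < N) (fcoef f n * r%:C%C ^+ n) * w ^+ n.
have L2S N : L2T (S N) by exact: (L2T_psum (fun n => fcoef f n * r%:C%C ^+ n) N).
have sqS N : sqT (S N) <= sqT f.
  rewrite (sqT_psum (fun n => fcoef f n * r%:C%C ^+ n)).
  apply: le_trans (bessel N L2f); apply: ler_sum => n _.
  rewrite Normc.normcM normcX normcR ger0_norm// exprMn.
  by rewrite ler_piMr ?sqr_ge0// !exprn_ile1 ?exprn_ge0// ltW.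
apply/ler_addgt0Pl => e e0.
have e20 : 0 < e / 2 by rewrite divr_gt0.
have [N _ hN] := null_small 0 e20 (null_geometric (sqT f + 1) r01).
have Fr0 : sqT (fun w => hev f (r%:C%C * w) - S N w) <= e / 2.
  apply: le_trans (ltW hN).
  have E : (sqT f + 1) * (r ^+ N * (1 - r)^-1) ^+ 2 =
      (Num.sqrt (sqT f + 1) * (r ^+ N * (1 - r)^-1)) ^+ 2.
    by rewrite [RHS]exprMn sqr_sqrtr// addr_ge0// sqT_ge0.
  have b0 : 0 <= r ^+ N * (1 - r)^-1.
    by rewrite mulr_ge0 ?exprn_ge0// invr_ge0 subr_ge0 ltW.
  rewrite E; apply: (L2T_bounded _ _ _).2.
  - exact: measT_sub L2r.1 (L2S N).1.
  - by rewrite mulr_ge0// sqrtr_ge0.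
  - apply: aeT_all => w w1.
    have Sb : 0 <= Num.sqrt (sqT f + 1) * (r ^+ N * (1 - r)^-1).
      by rewrite mulr_ge0// sqrtr_ge0.
    rewrite -(ler_pXn2r (n := 2)) ?nnegrE ?normc_ge0//.
    apply: (@le_trans _ _ ((sqT f + 1) * (r ^+ N * (1 - r)^-1) ^+ 2)); last by rewrite E.
    have -> : S N w = \sum_(n < N) fcoef f n * (r%:C%C * w) ^+ n.
      by apply: eq_bigr => n _; rewrite exprMn mulrA.
    have := hev_psum N L2f (disk_circle r01 w1).
    by rewrite normcR_ge0// w1 mulr1.
have := sqT_add_le (L2T_sub L2r (L2S N)) (L2S N).
rewrite (sqT_eq (g := fun w => hev f (r%:C%C * w))); last by move=> w _; rewrite subrK.
have := sqS N; lra.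
Qed.

Lemma bernoulli_le (r : R) n : 0 <= r <= 1 -> 1 - r ^+ n <= n%:R * (1 - r).
Proof.
move=> /andP[r0 r1]; elim: n => [|n IH]; first by rewrite expr0 subrr mul0r.
rewrite exprS -natr1 mulrDl mul1r.
have rn : r ^+ n <= 1 by exact: exprn_ile1.
have rn0 : 0 <= r ^+ n by exact: exprn_ge0.
nra.
Qed.

Lemma poly_dilate p : exists2 C : R, 0 <= C & forall (r : R), 0 <= r < 1 ->
  sqT (fun w => p.[r%:C%C * w] - p.[w]) <= (C * (1 - r)) ^+ 2.
Proof.
pose C : R := \sum_(k < size p) normc p`_k * k%:R.
have C0 : 0 <= C by apply: sumr_ge0 => k _; rewrite mulr_ge0// normc_ge0.
exists C => // r /andP[r0 r1].
apply: (L2T_bounded _ _ _).2.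
- apply: measT_sub; apply: measT_horner; last exact: measT_id.
  by apply: measT_mul (measT_cst _) _; exact: measT_id.
- by rewrite mulr_ge0// subr_ge0 ltW.
- apply: aeT_all => w w1; rewrite !horner_coef -sumrB /C mulr_suml.
  apply: le_trans (normc_sum _ _ _) _; apply: ler_sum => k _.
  have -> : p`_k * (r%:C%C * w) ^+ k - p`_k * w ^+ k = p`_k * (r ^+ k - 1)%:C%C * w ^+ k.
    by rewrite rmorphB rmorphXn rmorph1 exprMn; ring.
  rewrite !Normc.normcM normcX w1 expr1n mulr1 -mulrA ler_wpM2l ?normc_ge0//.
  rewrite normcR distrC ger0_norm ?subr_ge0 ?exprn_ile1 ?(ltW r1)//.
  by apply: bernoulli_le; rewrite r0 ltW.
Qed.

(** Between f and its dilate one inserts a polynomial p close to f and the dilate of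
    p; sqT_dilate controls the dilate of f - p and poly_dilate that of p. *)
Lemma polycl_hardy_boundary f : polycl f -> hardy_boundary (hev f) f.
Proof.
move=> [L2f fe]; split => //.
  exists (fcoef f); split; last by move=> z zD; exact: hev_series.
  apply: nondecreasing_is_cvgn.
    move=> m n mn; rewrite /series/= (big_cat_nat (leq0n m) mn)/= lerDl.
    by apply: sumr_ge0 => k _; exact: sqr_ge0.
  exists (sqT f) => _ [N _ <-]; rewrite /series/= big_mkord; exact: bessel.
apply/cvgrPdist_lt => e e0.
pose d := e ^+ 2 / 20.
have d0 : 0 < d by rewrite divr_gt0// exprn_gt0.
have [p pd] := fe _ d0; have [C C0 hC] := poly_dilate p.
have rC : (fun r : R => (C * (1 - r)) ^+ 2) r @[r --> (1 : R)^'-] --> (0 : R).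
  have h : (fun r : R => C * (1 - r)) r @[r --> (1 : R)^'-] --> (0 : R).
    rewrite -(mulr0 C); apply: cvgMr.
    rewrite -(subrr (1 : R)); apply: cvgB; first exact: cvg_cst.
    by apply: cvg_at_left_filter; exact: cvg_id.
  rewrite -(mulr0 (0 : R)); exact: cvgM.
move/cvgrPdist_lt/(_ _ d0): rC => rC; near=> r.
have r01 : 0 <= r < 1 by near: r; exact: near_at_left1.
have Cr : (C * (1 - r)) ^+ 2 < d.
  apply: le_lt_trans (ler_norm _) _; rewrite -normrN -sub0r; exact: (near rC r).
have L2p := L2T_horner p; have L2fp := L2T_sub L2f L2p.
have [L2r le_r] := sqT_dilate L2fp r01.
have [L2pr _] := sqT_dilate L2p r01.
have [L2fr _] := sqT_dilate L2f r01.
have prE w : normc w = 1 -> hev (fun w => p.[w]) (r%:C%C * w) = p.[r%:C%C * w].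
  by move=> w1; rewrite hev_horner//; exact: disk_circle.
rewrite sub0r normrN ger0_norm ?sqrtr_ge0// -(ltr_pXn2r (n := 2)) ?nnegrE ?sqrtr_ge0 ?(ltW e0)//.
rewrite -sqT_normT.
apply: le_lt_trans (sqT_sub_le L2fr L2pr L2f) _.
have h1 : sqT (fun w => hev f (r%:C%C * w) - hev (fun w => p.[w]) (r%:C%C * w)) <= 2 * d.
  rewrite (sqT_eq (g := fun w => hev (fun w => f w - p.[w]) (r%:C%C * w))).
    by have := pd; lra.
  by move=> w w1; rewrite hevB//; exact: disk_circle.
have h2 := sqT_sub_le L2pr L2p L2f.
have h3 : sqT (fun w => hev (fun w => p.[w]) (r%:C%C * w) - p.[w]) <= d.
  rewrite (sqT_eq (g := fun w => p.[r%:C%C * w] - p.[w])).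
    by apply: ltW; apply: le_lt_trans (hC r r01) Cr.
  by move=> w /prE ->.
have h4 : sqT (fun w => p.[w] - f w) < d by rewrite sqT_subC.
have : e ^+ 2 = 20 * d by rewrite /d mulrC divfK.
lra.
Unshelve. all: by end_near. Qed.

Lemma H2_polycl f : H2 f <-> polycl f.
Proof.
split=> [[F /hardy_boundary_hev[]//]|clf].
by exists (hev f); exact: polycl_hardy_boundary.
Qed.

(** All extensions of f agree with hev f on the disk, so the choice made in hval is
    immaterial. *)
Lemma hval_hev f z : H2 f -> disk z -> hval f z = hev f z.
Proof.
move=> /H2_polycl/polycl_hardy_boundary Ff zD; rewrite /hval.
have : [set w | exists2 F, hardy_boundary F f & w = F z] (hev f z).
  by exists (hev f).
by move=> /(@xgetI _ 0) [F /hardy_boundary_hev[_ FE] ->]; exact: FE.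
Qed.

End hardy_space.

#[local] Opaque hval H2.

(** * Multiplication, division and point values *)

Section hardy_algebra.
Variable R : realType.
Implicit Types (f g h F : R[i] -> R[i]) (c z w : R[i]) (p q : {poly R[i]}).

Lemma H2_L2T f : H2 f -> L2T f.
Proof. by move=> /H2_polycl[]. Qed.

Lemma H2_measT f : H2 f -> measT f.
Proof. by move=> /H2_L2T[]. Qed.

Lemma H2_eqT f g : measT g -> eqT f g -> H2 f -> H2 g.
Proof. by move=> mg fg /H2_polycl h; apply/H2_polycl; exact: polycl_eqT h. Qed.

Lemma H2_horner p : H2 (fun z => p.[z]).
Proof. by apply/H2_polycl; exact: polycl_horner. Qed.

Lemma H2_cst c : H2 (fun=> c).
Proof. by have := H2_horner c%:P; under eq_fun do rewrite hornerC. Qed.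

Lemma H2_id : H2 (fun z : R[i] => z).
Proof. by have := H2_horner 'X; under eq_fun do rewrite hornerX. Qed.

Lemma H2_add f g : H2 f -> H2 g -> H2 (fun z => f z + g z).
Proof. by move=> /H2_polycl ? /H2_polycl ?; apply/H2_polycl; exact: polycl_add. Qed.

Lemma H2_scale c f : H2 f -> H2 (fun z => c * f z).
Proof. by move=> /H2_polycl ?; apply/H2_polycl; exact: polycl_scale. Qed.

Lemma H2_sub f g : H2 f -> H2 g -> H2 (fun z => f z - g z).
Proof.
move=> H2f /(H2_scale (-1))/(H2_add H2f); congr (@H2 R).
by apply/funext => z; rewrite mulN1r.
Qed.

Lemma H2_closed f : L2T f ->
  (forall e : R, 0 < e -> exists2 g, H2 g & sqT (fun z => f z - g z) < e) -> H2 f.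
Proof.
move=> L2f h; apply/H2_polycl; apply: polycl_closed => // e /h[g /H2_polycl ? ?].
by exists g.
Qed.

Lemma H2_szego z : disk z -> H2 (szego z).
Proof. by move=> zD; apply/H2_polycl; exact: polycl_szego. Qed.

Lemma eqT_circle f g : (forall z, normc z = 1 -> f z = g z) -> eqT f g.
Proof. exact: aeT_all. Qed.

Lemma eqT_refl f : eqT f f.
Proof. exact: eqT_circle. Qed.

Lemma hval_eqT f g z : H2 f -> measT g -> eqT f g -> disk z -> hval g z = hval f z.
Proof.
move=> H2f mg fg zD; have H2g := H2_eqT mg fg H2f; rewrite !hval_hev//.
have mk := measT_szego z; apply: innerT_ae => //; first exact: H2_measT.
- by apply: eqT_mp (eqT_aeT fg) => ? _ ->.
- exact: eqT_refl.
Qed.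

Lemma hvalD f g z : H2 f -> H2 g -> disk z ->
  hval (fun w => f w + g w) z = hval f z + hval g z.
Proof.
move=> H2f H2g zD; rewrite (hval_hev (H2_add H2f H2g) zD) (hval_hev H2f zD) (hval_hev H2g zD).
by apply: innerTDl; [exact: H2_L2T|exact: H2_L2T|exact: L2T_szego].
Qed.

Lemma hvalZ c f z : H2 f -> disk z -> hval (fun w => c * f w) z = c * hval f z.
Proof.
move=> H2f zD; rewrite (hval_hev (H2_scale c H2f) zD) (hval_hev H2f zD).
by apply: innerTZl; [exact: H2_L2T|exact: L2T_szego].
Qed.

Lemma hvalB f g z : H2 f -> H2 g -> disk z ->
  hval (fun w => f w - g w) z = hval f z - hval g z.
Proof.
move=> H2f H2g zD; rewrite (hval_hev (H2_sub H2f H2g) zD) (hval_hev H2f zD) (hval_hev H2g zD).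
by apply: hevB => //; exact: H2_L2T.
Qed.

Lemma hval_horner p z : disk z -> hval (fun w => p.[w]) z = p.[z].
Proof. by move=> zD; rewrite hval_hev ?hev_horner//; exact: H2_horner. Qed.

Lemma hval_cst c z : disk z -> hval (fun=> c) z = c.
Proof.
by move=> /(hval_horner c%:P); under eq_fun do rewrite hornerC; rewrite hornerC.
Qed.

Lemma hval_bound f z : H2 f -> disk z ->
  normc (hval f z) ^+ 2 <= (sqT (szego z) + 1) * sqT f.
Proof.
move=> H2f zD; rewrite hval_hev//; apply: innerT_bound; first exact: H2_L2T.
exact: L2T_szego.
Qed.

Definition bddT f : Prop := exists2 M : R, 0 <= M & aeT (fun z => normc (f z) <= M).

Lemma bddT_le f (M : R) : aeT (fun z => normc (f z) <= M) -> bddT f.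
Proof.
move=> fM; exists `|M| => //; apply: aeT_mp fM => z _ h.
exact: le_trans (ler_norm _).
Qed.

Lemma bddT_cst c : bddT (fun=> c).
Proof. by apply: (bddT_le (M := normc c)); exact: aeT_all. Qed.

Lemma bddT_id : bddT (fun z : R[i] => z).
Proof. by apply: (bddT_le (M := 1)); apply: aeT_all => z ->. Qed.

Lemma bddT_add f g : bddT f -> bddT g -> bddT (fun z => f z + g z).
Proof.
move=> [M _ fM] [N _ gN]; apply: (bddT_le (M := M + N)).
apply: aeT_mp (aeT_and fM gN) => z _ [h k].
exact: le_trans (le_normcD _ _) (lerD h k).
Qed.

Lemma bddT_mul f g : bddT f -> bddT g -> bddT (fun z => f z * g z).
Proof.
move=> [M M0 fM] [N N0 gN]; apply: (bddT_le (M := M * N)).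
apply: aeT_mp (aeT_and fM gN) => z _ [h k].
by rewrite Normc.normcM ler_pM// normc_ge0.
Qed.

Lemma bddT_sub f g : bddT f -> bddT g -> bddT (fun z => f z - g z).
Proof.
move=> fb /(bddT_mul (bddT_cst (-1)))/(bddT_add fb); congr bddT.
by apply/funext => z; rewrite mulN1r.
Qed.

Lemma bddT_horner p f : bddT f -> bddT (fun z => p.[f z]).
Proof.
move=> fb; elim/poly_ind: p => [|p c IH].
  by under eq_fun do rewrite horner0; exact: bddT_cst.
under eq_fun do rewrite hornerMXaddC.
by apply: bddT_add (bddT_cst _); exact: bddT_mul.
Qed.

Lemma L2T_mul f g : bddT f -> measT f -> L2T g -> L2T (fun z => f z * g z).
Proof.
move=> [M M0 fM] mf L2g; exact: (L2T_mul_bounded mf L2g M0 fM).1.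
Qed.

(** Polynomial approximations of g give approximations of f g, f being bounded. *)
Lemma H2_mul_of f g : bddT f -> measT f -> (forall p, H2 (fun z => f z * p.[z])) ->
  H2 g -> H2 (fun z => f z * g z).
Proof.
move=> fb mf fp /H2_polycl[L2g ge].
apply: H2_closed => [|e e0]; first exact: L2T_mul.
have [M M0 fM] := fb; have M1 : 0 < M ^+ 2 + 1 by rewrite ltr_wpDl// sqr_ge0.
have [p pe] := ge _ (divr_gt0 e0 M1); exists (fun z => f z * p.[z]) => //.
rewrite (sqT_eq (g := fun z => f z * (g z - p.[z]))); last by move=> z _; rewrite mulrBr.
apply: le_lt_trans (L2T_mul_bounded mf (L2T_sub L2g (L2T_horner p)) M0 fM).2 _.
move: pe; rewrite ltr_pdivlMr//; apply: le_lt_trans.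
by rewrite mulrC ler_wpM2l ?sqT_ge0// lerDl.
Qed.

(** H2_mul_of is used twice: for f times a polynomial, with the polynomial as the
    bounded factor, and then for f times g. *)
Lemma H2_mul f g : H2 f -> bddT f -> H2 g -> H2 (fun z => f z * g z).
Proof.
move=> H2f fb; apply: H2_mul_of => //; first exact: H2_measT.
move=> p; under eq_fun do rewrite mulrC.
apply: H2_mul_of H2f => [||q].
- exact: (bddT_horner p bddT_id).
- exact: H2_measT (H2_horner p).
- by under eq_fun do rewrite -hornerM; exact: H2_horner.
Qed.

(** True for polynomials, and the integral is continuous in f. *)
Lemma intT_zmul f : H2 f -> intT (fun z => z * f z) = 0.
Proof.
move=> /[dup] H2f /H2_polycl[L2f fe].
have -> : intT (fun z => z * f z) = fcoef (fun z => z * f z) 0.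
  by apply: intT_eq => z _; rewrite expr0 conjc1 mulr1.
have L2zf g : L2T g -> L2T (fun z => z * g z).
  by apply: L2T_mul; [exact: bddT_id|exact: measT_id].
apply: Normc.eq0_normc; apply/eqP; rewrite -sqrf_eq0 eq_le sqr_ge0 andbT.
apply/ler_addgt0Pl => e e0; rewrite addr0.
have e20 : 0 < e / 2 by rewrite divr_gt0.
have [p pe] := fe _ e20.
have p0 : fcoef (fun z => z * p.[z]) 0 = 0.
  under [X in fcoef X]eq_fun do rewrite -[z in z * _]hornerX -hornerM.
  by rewrite fcoef_horner coefXM.
rewrite -[fcoef _ _]subr0 -p0 -fcoefB; [|exact: L2zf|by apply: L2zf; exact: L2T_horner].
have L2fp := L2T_sub L2f (L2T_horner p).
rewrite /fcoef (innerT_eq (f' := fun z => z * (f z - p.[z])) (g' := fun z => z ^+ 0))//;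
  last by move=> z _; rewrite mulrBr.
apply: le_trans (fcoef_bound 0 (L2zf _ L2fp)) _.
have -> : sqT (fun z => z * (f z - p.[z])) = sqT (fun z => f z - p.[z]).
  apply: eq_meanT => t _.
  by rewrite Normc.normcM normc_expi mul1r.
by lra.
Qed.

Lemma circle_sub_ge z w : disk z -> normc w = 1 -> 1 - normc z <= normc (w - z).
Proof. by move=> zD w1; have := normc_subr w z; rewrite w1. Qed.

Lemma circle_sub_neq0 z w : disk z -> normc w = 1 -> w - z != 0.
Proof.
move=> zD w1; rewrite -normc_gt0; apply: lt_le_trans (circle_sub_ge zD w1).
by rewrite subr_gt0.
Qed.

Lemma circle_sub_inv z w : disk z -> normc w = 1 ->
  normc (w - z)^-1 <= (1 - normc z)^-1.
Proof.
move=> zD w1; rewrite Normc.normcV lef_pV2 ?circle_sub_ge// posrE ?subr_gt0//.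
by rewrite normc_gt0 circle_sub_neq0.
Qed.

Lemma measT_inv_sub z : measT (fun w => (w - z)^-1).
Proof. by apply: measT_inv; exact: measT_sub (@measT_id R) (measT_cst z). Qed.

Lemma bddT_inv_sub z : disk z -> bddT (fun w => (w - z)^-1).
Proof.
move=> zD; apply: (bddT_le (M := (1 - normc z)^-1)); apply: aeT_all => w w1.
exact: circle_sub_inv.
Qed.

(** For a polynomial p the quotient (p - p(z)) / (w - z) is a polynomial, and
    1 / (w - z) is bounded on the circle. *)
Lemma H2_div f z : H2 f -> disk z -> H2 (fun w => (f w - hval f z) / (w - z)).
Proof.
move=> /[dup] H2f /H2_polycl[L2f fe] zD.
have divE g : (fun w => g w / (w - z)) = (fun w => (w - z)^-1 * g w).
  by apply/funext => w; rewrite mulrC.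
have L2div g : L2T g -> L2T (fun w => g w / (w - z)).
  by move=> L2g; rewrite divE; apply: L2T_mul L2g; [exact: bddT_inv_sub|exact: measT_inv_sub].
apply: H2_closed => [|e e0].
  by apply: L2div; apply: L2T_sub => //; exact: L2T_cst.
pose K := (1 - normc z)^-1 ^+ 2 * (2 + 2 * (sqT (szego z) + 1)).
have K0 : 0 <= K by rewrite mulr_ge0 ?sqr_ge0// addr_ge0// mulr_ge0// addr_ge0// sqT_ge0.
have K1 : 0 < K + 1 by rewrite ltr_wpDl.
have [p pe] := fe _ (divr_gt0 e0 K1).
have /factor_theorem[q qE] : root (p - p.[z]%:P) z.
  by rewrite /root hornerD hornerN hornerC subrr.
exists (fun w => q.[w]); first exact: H2_horner.
have H2fp := H2_sub H2f (H2_horner p).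
pose g w := f w - p.[w]; pose c := hval g z.
have cE : c = hval f z - p.[z] by rewrite /c (hvalB H2f (H2_horner p) zD) (hval_horner p zD).
have qw w : normc w = 1 -> q.[w] = (p.[w] - p.[z]) / (w - z).
  move=> w1; have := congr1 (fun r => r.[w]) qE.
  rewrite !hornerE => ->; rewrite mulfK//; exact: circle_sub_neq0.
rewrite (sqT_eq (g := fun w => (w - z)^-1 * (g w - c))); last first.
  by move=> w w1; rewrite qw// cE /g; ring.
have L2gc : L2T (fun w => g w - c) by apply: L2T_sub (L2T_cst c); exact: H2_L2T.
have V0 := disk_inv_ge0 zD.
have bd : aeT (fun w => normc (w - z)^-1 <= (1 - normc z)^-1).
  by apply: aeT_all => w; exact: circle_sub_inv.
have [_ h] := L2T_mul_bounded (measT_inv_sub z) L2gc V0 bd; apply: le_lt_trans h _.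
have h1 : sqT (fun w => g w - c) <= 2 * sqT g + 2 * ((sqT (szego z) + 1) * sqT g).
  have := sqT_add_le (H2_L2T H2fp) (L2T_cst (- c)).
  rewrite sqT_cst normcN => /le_trans; apply.
  by rewrite lerD2l ler_pM2l//; exact: hval_bound.
have gE : sqT g < e / (K + 1) by [].
rewrite ltr_pdivlMr// in gE; apply: le_lt_trans gE.
apply: le_trans (ler_wpM2l (sqr_ge0 _) h1) _.
have -> : (1 - normc z)^-1 ^+ 2 * (2 * sqT g + 2 * ((sqT (szego z) + 1) * sqT g)) =
  sqT g * K by rewrite /K; ring.
by rewrite ler_wpM2l ?sqT_ge0// lerDl.
Qed.

(** Write g = g(z) + (w - z) q with q in H^2. On the circle (w - z) conj (szego z w) = w,
    so the second part contributes the integral of w f q, which vanishes. *)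
Lemma hvalM f g z : H2 f -> bddT f -> H2 g -> disk z ->
  hval (fun w => f w * g w) z = hval f z * hval g z.
Proof.
move=> H2f fb H2g zD; have H2q := H2_div H2g zD.
set q := (fun w => (g w - hval g z) / (w - z)) in H2q.
have qE w : normc w = 1 -> g w = hval g z + (w - z) * q w.
  move=> w1; rewrite /q mulrCA divff ?mulr1; first by rewrite addrCA subrr addr0.
  exact: circle_sub_neq0 zD w1.
clearbody q.
have H2fq : H2 (fun w => f w * q w) := H2_mul H2f fb H2q.
have H2zfq : H2 (fun w => (w - z) * (f w * q w)).
  exact: (H2_mul (H2_sub H2_id (H2_cst z)) (bddT_sub bddT_id (bddT_cst z)) H2fq).
have vanish : hval (fun w => (w - z) * (f w * q w)) z = 0.
  rewrite (hval_hev H2zfq zD) -[RHS](intT_zmul H2fq).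
  apply: intT_eq => w w1; rewrite /szego conjcV conjcB conjcM conjcK conjc1.
  have d0 : 1 - z * conjc w != 0.
    have := szego_den_neq0 zD w1; apply: contra => /eqP h; apply/eqP.
    by rewrite -(conjcK w) -conjcM -[1]conjc1 -conjcB h conjc0.
  have -> : w - z = w * (1 - z * conjc w).
    by rewrite mulrBr mulr1 mulrCA unit_conjc// mulr1.
  by rewrite -!mulrA; congr (_ * _); rewrite mulrC -!mulrA mulVf// mulr1.
have H2s := H2_add (H2_scale (hval g z) H2f) H2zfq.
rewrite (hval_eqT H2s (measT_mul (H2_measT H2f) (H2_measT H2g)) _ zD).
  rewrite (hvalD (H2_scale (hval g z) H2f) H2zfq zD) (hvalZ _ H2f zD) vanish.
  by rewrite addr0; exact: mulrC.
by apply: eqT_circle => w w1 /=; rewrite (qE w w1); ring.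
Qed.

(** With k the kernel at z, f k - f(z) k is orthogonal to k. *)
Lemma sqT_szego_sub f z : H2 f -> bddT f -> disk z ->
  sqT (fun w => f w * szego z w - hval f z * szego z w) =
  sqT (fun w => f w * szego z w) - normc (hval f z) ^+ 2 * sqT (szego z).
Proof.
move=> H2f fb zD; have H2k := H2_szego zD; have L2k := H2_L2T H2k.
have H2fk := H2_mul H2f fb H2k.
apply: complexI; rewrite sqT_sub_scale//; last exact: H2_L2T.
have -> : innerT (fun w => f w * szego z w) (szego z) = hval f z * (sqT (szego z))%:C%C.
  rewrite -/(hev _ _) -hval_hev// hvalM// (hval_hev H2k)// /hev innerT_self.
  by [].
rewrite conjcM conjc_real.
set c := hval f z; set K := sqT (szego z); set S := sqT _.
have -> : (S - normc c ^+ 2 * K)%:C%C = S%:C%C - (normc c ^+ 2)%:C%C * K%:C%C by ring.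
by rewrite -mul_conjc; ring.
Qed.

Lemma sqT_szego_gt0 z : disk z -> 0 < sqT (szego z).
Proof.
move=> zD; rewrite lt_def sqT_ge0 andbT; apply/eqP => /(congr1 (real_complex R)).
rewrite -innerT_self -/(hev _ _) => h.
have one1 : hev (fun=> 1) z = 1.
  by rewrite -hval_hev ?hval_cst//; exact: H2_cst.
have L2k := L2T_szego zD.
have := innerT_bound (L2T_cst 1) L2k.
have := innerT_bound L2k (L2T_cst 1).
have -> : sqT (szego z) = 0 by apply: complexI; rewrite -innerT_self.
rewrite mulr0 innerTC//; last exact: L2T_cst.
by rewrite normcJ -/(hev _ _) one1 Normc.normc1 expr1n ler10.
Qed.

(** The left-hand side of sqT_szego_sub is nonnegative. *)
Lemma hval_le f z (M : R) : H2 f -> 0 <= M -> aeT (fun w => normc (f w) <= M) ->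
  disk z -> normc (hval f z) <= M.
Proof.
move=> H2f M0 fM zD; have fb : bddT f by exists M.
have := sqT_ge0 (fun w => f w * szego z w - hval f z * szego z w).
rewrite sqT_szego_sub// subr_ge0 => h.
rewrite -(ler_pXn2r (n := 2)) ?nnegrE ?normc_ge0// -(ler_pM2r (sqT_szego_gt0 zD)).
apply: le_trans h _.
exact: (L2T_mul_bounded (H2_measT H2f) (L2T_szego zD) M0 fM).2.
Qed.

(** The equality case of the maximum principle: the left-hand side of sqT_szego_sub
    vanishes. *)
Lemma unimodular_cst f z : H2 f -> aeT (fun w => normc (f w) = 1) -> disk z ->
  1 <= normc (hval f z) -> eqT f (fun=> hval f z).
Proof.
move=> H2f f1 zD c1.
have f1' : aeT (fun w => normc (f w) <= 1) by apply: aeT_mp f1 => w _ ->.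
have fb : bddT f by exists 1.
have k0 := sqT_szego_gt0 zD.
have H2fk := H2_mul H2f fb (H2_szego zD).
have : sqT (fun w => f w * szego z w - hval f z * szego z w) = 0.
  apply/eqP; rewrite eq_le sqT_ge0 andbT sqT_szego_sub// subr_le0.
  have := (L2T_mul_bounded (H2_measT H2f) (L2T_szego zD) ler01 f1').2.
  rewrite expr1n mul1r => /le_trans; apply.
  by rewrite ler_peMl ?sqT_ge0// exprn_ege1.
move/sqT_eq0; have L2d : L2T (fun w => f w * szego z w - hval f z * szego z w).
  by apply: L2T_sub; [exact: H2_L2T|apply: L2T_scale; exact: L2T_szego].
move/(_ L2d)/eqT_aeT; apply: eqT_mp => w w1 /eqP.
rewrite -mulrBl mulf_eq0 invr_eq0 (negbTE (szego_den_neq0 zD w1)) orbF subr_eq0.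
by move/eqP.
Qed.

Lemma H2_hval_horner p f : H2 f -> bddT f ->
  H2 (fun w => p.[f w]) /\ forall z, disk z -> hval (fun w => p.[f w]) z = p.[hval f z].
Proof.
move=> H2f fb; elim/poly_ind: p => [|p c [IH1 IH2]].
  under eq_fun do rewrite horner0; split; first exact: H2_cst.
  by move=> z zD; rewrite horner0 hval_cst.
have pb := bddT_horner p fb.
have H2pf : H2 (fun w => p.[f w] * f w) by exact: H2_mul.
under eq_fun do rewrite hornerMXaddC; split; first exact: H2_add H2pf (H2_cst c).
move=> z zD; rewrite hornerMXaddC (hvalD H2pf (H2_cst c) zD) (hval_cst c zD).
by rewrite (hvalM IH1 pb H2f zD) (IH2 z zD).
Qed.

(** Uniform approximation on the disk of radius rho gives approximation in L^2, and
    also of the point values since these are bounded by the supremum norm. *)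
Lemma H2_comp (A : R[i] -> R[i]) (P : nat -> {poly R[i]}) (u : nat -> R) (rho : R) f :
  0 <= rho -> u @ \oo --> (0 : R) ->
  (forall n x, normc x <= rho -> normc (A x - (P n).[x]) <= u n) ->
  H2 f -> aeT (fun w => normc (f w) <= rho) -> measT (fun w => A (f w)) ->
  [/\ H2 (fun w => A (f w)), bddT (fun w => A (f w)) &
      forall z, disk z -> hval (fun w => A (f w)) z = A (hval f z)].
Proof.
move=> rho0 u0 Au H2f frho mA; have fb : bddT f by exists rho.
have Hp n := H2_hval_horner (P n) H2f fb.
have un n : 0 <= u n.
  by apply: le_trans (Au n 0 _); rewrite ?normc_ge0// Normc.normc0.
have dist n : aeT (fun w => normc (A (f w) - (P n).[f w]) <= u n).
  by apply: aeT_mp frho => w _; exact: Au.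
have mp n : measT (fun w => (P n).[f w]) by exact: H2_measT (Hp n).1.
have dist2 n := L2T_bounded (measT_sub mA (mp n)) (un n) (dist n).
have L2A : L2T (fun w => A (f w)).
  have -> : (fun w => A (f w)) = (fun w => (A (f w) - (P 0).[f w]) + (P 0).[f w]).
    by apply/funext => w; rewrite subrK.
  by apply: L2T_add; [exact: (dist2 0).1|exact: H2_L2T (Hp 0).1].
have H2A : H2 (fun w => A (f w)).
  apply: H2_closed => // e e0.
  have u20 : (fun n => u n ^+ 2) @ \oo --> (0 : R).
    by rewrite -(mulr0 (0 : R)); exact: cvgM.
  have [n _ hn] := null_small 0 e0 u20.
  by exists (fun w => (P n).[f w]); [exact: (Hp n).1|exact: le_lt_trans (dist2 n).2 hn].
split => // [|z zD].
  have : bddT (fun w => (A (f w) - (P 0).[f w]) + (P 0).[f w]).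
    by apply: bddT_add; [exists (u 0) => //; exact: dist|exact: bddT_horner].
  by congr bddT; apply/funext => w; rewrite subrK.
apply/eqP; rewrite -subr_eq0; apply/eqP.
apply: (normc_null_eq (u := fun n => u n + u n)); last first.
  by rewrite -(addr0 (0 : R)); exact: cvgD.
move=> n; have -> : hval (fun w => A (f w)) z - A (hval f z) =
    hval (fun w => A (f w) - (P n).[f w]) z - (A (hval f z) - (P n).[hval f z]).
  by rewrite (hvalB H2A (Hp n).1 zD) ((Hp n).2 z zD); ring.
apply: le_trans (le_normcD _ _) _; rewrite normcN; apply: lerD.
  exact: (hval_le (H2_sub H2A (Hp n).1) (un n) (dist n) zD).
by apply: Au; exact: hval_le H2f rho0 frho zD.
Qed.

End hardy_algebra.

(** * Toeplitz kernels and Crofoot isometries *)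

Section toeplitz_kernels.
Variable R : realType.
Implicit Types (f g h : R[i] -> R[i]) (c z w : R[i]).

(** The algebra H^oo, by boundary values. *)
Definition Hinf f : Prop := H2 f /\ bddT f.

Lemma Hinf_cst c : Hinf (fun=> c).
Proof. by split; [exact: H2_cst|exact: bddT_cst]. Qed.

Lemma Hinf_id : Hinf (fun z : R[i] => z).
Proof. by split; [exact: H2_id|exact: bddT_id]. Qed.

Lemma Hinf_sub f g : Hinf f -> Hinf g -> Hinf (fun z => f z - g z).
Proof.
by move=> [f1 f2] [g1 g2]; split; [exact: (H2_sub f1 g1)|exact: (bddT_sub f2 g2)].
Qed.

Lemma Hinf_mul f g : Hinf f -> Hinf g -> Hinf (fun z => f z * g z).
Proof.
by move=> [f1 f2] [g1 g2]; split; [exact: (H2_mul f1 f2 g1)|exact: (bddT_mul f2 g2)].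
Qed.

Lemma Hinf_measT f : Hinf f -> measT f.
Proof. by move=> [/H2_measT]. Qed.

Lemma Hinf_geometric f (rho : R) : H2 f -> rho < 1 ->
  aeT (fun z => normc (f z) <= rho) -> Hinf (fun z => (1 - f z)^-1).
Proof.
move=> H2f rho1 frho; pose r := Num.max rho 0.
have r0 : 0 <= r by rewrite le_max lexx orbT.
have r1 : r < 1 by rewrite gt_max rho1 ltr01.
have fr : aeT (fun z => normc (f z) <= r).
  by apply: aeT_mp frho => z _ h; rewrite le_max h.
have u0 : (fun N => r ^+ N * (1 - r)^-1) @ \oo --> (0 : R).
  rewrite -(mul0r (1 - r)^-1); apply: cvgMl; apply: null_expr; by rewrite r0.
have mA : measT (fun z => (1 - f z)^-1).
  exact: measT_inv (measT_sub (measT_cst 1) (H2_measT H2f)).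
have approx n x : normc x <= r ->
    normc ((1 - x)^-1 - (\poly_(k < n) 1).[x]) <= r ^+ n * (1 - r)^-1.
  move=> xr; have d : 1 - r <= normc (1 - x).
    by apply: le_trans (normc_1B_ge x); rewrite lerD2l lerN2.
  have d0 : 0 < normc (1 - x) by apply: lt_le_trans d; rewrite subr_gt0.
  have x1 : 1 - x != 0 by rewrite -normc_gt0.
  rewrite horner_poly; under eq_bigr do rewrite mul1r.
  rewrite sum_geometric; last by rewrite eq_sym -subr_eq0.
  have -> : (1 - x)^-1 - (1 - x ^+ n) / (1 - x) = x ^+ n * (1 - x)^-1 by field.
  rewrite Normc.normcM normcX Normc.normcV; apply: ler_pM.
  - by rewrite exprn_ge0// normc_ge0.
  - by rewrite invr_ge0 normc_ge0.
  - by rewrite lerXn2r ?nnegrE ?normc_ge0.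
  - by rewrite lef_pV2 ?posrE ?subr_gt0.
by have [? ? _] := H2_comp (A := fun x => (1 - x)^-1) r0 u0 approx H2f fr mA.
Qed.

(** The bound on the extension required of inner functions follows from hval_le. *)
Lemma innerP f : inner f <-> H2 f /\ aeT (fun z => normc (f z) = 1).
Proof.
split=> [[[F [Ff _]] f1]|[H2f f1]].
  by split => //; apply/H2_polycl; exact: (hardy_boundary_hev Ff).1.
split => //; exists (hev f); split.
  exact: polycl_hardy_boundary ((H2_polycl _).1 H2f).
exists 1 => z zD; rewrite -(hval_hev H2f zD); apply: (hval_le H2f ler01 _ zD).
by apply: aeT_mp f1 => w _ ->.
Qed.

Lemma inner_Hinf f : inner f -> Hinf f.
Proof.
move/innerP => [H2f f1]; split => //; apply: (bddT_le (M := 1)).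
by apply: aeT_mp f1 => w _ ->.
Qed.

Lemma kerTE g f : kerT g f <->
  H2 f /\ forall q, H2 q -> innerT (fun z => g z * f z) q = 0.
Proof.
have E q : innerT (fun z => g z * f z - 0) q = innerT (fun z => g z * f z) q.
  by apply: innerT_eq => // z _; rewrite subr0.
split=> [[H2f [_ h]]|[H2f h]]; split => //.
- by move=> q /h <-; rewrite E.
- by split => [|q /h]; [exact: H2_cst|rewrite E].
Qed.

Lemma innerT_mulr f g (q : R[i] -> R[i]) : innerT (fun z => conjc (g z) * f z) q = innerT f (fun z => g z * q z).
Proof. by apply: intT_eq => z _; rewrite conjcM mulrCA mulrA. Qed.

Lemma kerT_eqT g f f' : measT g -> measT f' -> eqT f f' -> kerT g f -> kerT g f'.
Proof.
move=> mg mf' ff' /kerTE[H2f h]; apply/kerTE; split; first exact: H2_eqT mf' ff' H2f.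
move=> q H2q; rewrite -(h q H2q).
apply: innerT_ae (measT_mul mg mf') (measT_mul mg (H2_measT H2f))
  (H2_measT H2q) (H2_measT H2q) _ (eqT_refl q).
by apply: eqT_mp (eqT_aeT ff') => z _ ->.
Qed.

(** If g w = conj w g2 on the circle with w invertible in H^oo, multiplication by w
    carries the kernel of T_g2 onto that of T_g: the orthogonal complement of H^2 is
    stable under multiplication by conjugates of H^oo functions. *)
Lemma kerT_transfer g g2 (w v : R[i] -> R[i]) : measT g -> measT g2 -> Hinf w -> Hinf v ->
  aeT (fun z => w z * v z = 1) -> aeT (fun z => g z * w z = conjc (w z) * g2 z) ->
  kerT g = mulset w (kerT g2).
Proof.
move=> mg mg2 [H2w bw] [H2v bv] wv gw.
have mw := H2_measT H2w; have mv := H2_measT H2v.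
apply/seteqP; split => f.
- move=> /kerTE[H2f h]; have mf := H2_measT H2f.
  split; first exact: mf.
  have H2vf : H2 (fun z => v z * f z) := H2_mul H2v bv H2f.
  exists (fun z => v z * f z); last first.
    by apply: eqT_mp wv => z _ wvz; rewrite mulrA wvz mul1r.
  apply/kerTE; split => // q H2q.
  rewrite -(h _ (H2_mul H2v bv H2q)) -innerT_mulr.
  apply: innerT_ae (eqT_refl q).
  + exact: measT_mul mg2 (measT_mul mv mf).
  + exact: measT_mul (measT_conj mv) (measT_mul mg mf).
  + exact: H2_measT H2q.
  + exact: H2_measT H2q.
  + apply: eqT_mp (aeT_and wv gw) => z _ [wvz gwz].
    have wvz' : conjc (v z) * conjc (w z) = 1.
      by rewrite -conjcM mulrC wvz conjc1.
    rewrite -[in RHS](mul1r (f z)) -wvz.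
    transitivity (conjc (v z) * (g z * w z) * (v z * f z)); last by ring.
    by rewrite gwz [conjc (v z) * _]mulrA wvz' mul1r.
- move=> [mf [h /kerTE[H2h hh] fh]].
  apply: (kerT_eqT (f := fun z => w z * h z) mg mf).
    by apply: eqT_mp (eqT_aeT fh) => z _ ->.
  apply/kerTE; split; first exact: H2_mul H2w bw H2h.
  move=> q H2q; rewrite -(hh _ (H2_mul H2w bw H2q)) -innerT_mulr.
  have mh := H2_measT H2h; apply: innerT_ae (eqT_refl q).
  + exact: measT_mul mg (measT_mul mw mh).
  + exact: measT_mul (measT_conj mw) (measT_mul mg2 mh).
  + exact: H2_measT H2q.
  + exact: H2_measT H2q.
  + by apply: eqT_mp gw => z _ gwz; rewrite mulrA gwz mulrA.
Qed.

Lemma sqT_unimodular f h : aeT (fun z => normc (f z) = 1) -> measT f -> L2T h ->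
  sqT (fun z => f z * h z) = sqT h.
Proof.
move=> f1 mf L2h; apply: meanT_ae.
- exact: measurable_normc_sqr (measT_mul mf L2h.1).
- exact: measurable_normc_sqr L2h.1.
- apply: (@filterS _ _ (ae_filter_ringOfSetsType _)) f1 => t f1 tA.
  by rewrite Normc.normcM f1// mul1r.
Qed.

(** The isometry behind Crofoot transforms. As (phi - a) h lies in psi H^2, it is
    orthogonal to h, so that <phi h, h> = a |h|^2; the formula is then the expansion
    of the square of h - conj a phi h. *)
Lemma sqT_crofoot phi psi (q : R[i] -> R[i]) (a : R[i]) h : inner phi -> measT psi -> Hinf q ->
  aeT (fun z => phi z - a = psi z * q z) -> modelK psi h ->
  sqT (fun z => (1 - conjc a * phi z) * h z) = (1 - normc a ^+ 2) * sqT h.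
Proof.
move=> phiI mpsi [H2q bq] phia /kerTE[H2h hh].
have [H2phi phi1] := (innerP phi).1 phiI; have [_ bphi] := inner_Hinf phiI.
have L2h := H2_L2T H2h; have H2ph := H2_mul H2phi bphi H2h.
have L2ph := H2_L2T H2ph; have mh := L2h.1; have mphi := H2_measT H2phi.
have H2qh := H2_mul H2q bq H2h.
have orth : innerT h (fun z => phi z * h z) = conjc a * (sqT h)%:C%C.
  have E : innerT h (fun z => phi z * h z - a * h z) = 0.
    rewrite -(hh _ H2qh) innerT_mulr.
    apply: innerT_ae (eqT_refl h) _ => //.
    - exact: measT_sub L2ph.1 (measT_mul (measT_cst a) mh).
    - exact: measT_mul mpsi (H2_measT H2qh).
    - by apply: eqT_mp phia => z _ pz; rewrite -mulrBl pz mulrA.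
  have := E; rewrite innerTBr ?innerTZr//; last exact: L2T_scale.
  by rewrite innerT_self => /eqP; rewrite subr_eq0 => /eqP.
rewrite (sqT_eq (g := fun z => h z - conjc a * (phi z * h z))); last by move=> z _; ring.
apply: complexI; rewrite sqT_sub_scale// sqT_unimodular// orth conjcM conjcK conjc_real normcJ.
transitivity ((sqT h)%:C%C - a * conjc a * (sqT h)%:C%C).
  by rewrite -(mul_conjc a); ring.
by rewrite mul_conjc; ring.
Qed.

(** Otherwise th would be a unimodular constant, and f orthogonal to itself. *)
Lemma hval_inner_lt1 th f z : inner th -> modelK th f -> ~ eqT f (fun=> 0) -> disk z ->
  normc (hval th z) < 1.
Proof.
move=> /innerP[H2th th1] /kerTE[H2f h] f0 zD; rewrite ltNge; apply/negP => c1.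
apply: f0; apply: sqT_eq0; first exact: H2_L2T H2f.
have thc := unimodular_cst H2th th1 zD c1.
have := h f H2f.
rewrite (innerT_ae (f' := fun z0 => conjc (hval th z) * f z0) (g' := f)).
- rewrite innerTZl; [|exact: H2_L2T H2f|exact: H2_L2T H2f].
  rewrite innerT_self => /eqP; rewrite mulf_eq0 conjc_eq0 -normc_eq0.
  by rewrite gt_eqF ?(lt_le_trans ltr01)//= => /eqP/complexI.
- exact: measT_mul (measT_conj (H2_measT H2th)) (H2_measT H2f).
- exact: measT_mul (measT_cst _) (H2_measT H2f).
- exact: H2_measT H2f.
- exact: H2_measT H2f.
- by apply: eqT_mp (eqT_aeT thc) => w _ ->.
- exact: eqT_refl.
Qed.

End toeplitz_kernels.

(** * The inner function th_mu *)

Section frostman_quotient.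
Variable R : realType.
Variables (th : R[i] -> R[i]) (mu : R[i]).
Hypotheses (thI : inner th) (muD : disk mu) (a1 : normc (hval th mu) < 1).
Implicit Types (z : R[i]).

Let a := hval th mu.

Lemma Hinf_inv_szego (l : R[i]) : disk l -> Hinf (fun z => (1 - conjc l * z)^-1).
Proof.
move=> lD; apply: (Hinf_geometric (rho := normc l)) lD _.
  exact: H2_scale _ (H2_id R).
by apply: aeT_all => z z1; rewrite Normc.normcM normcJ z1 mulr1.
Qed.

Lemma Hinf_1B_conj (l : R[i]) : Hinf (fun z => 1 - conjc l * z).
Proof. exact: Hinf_sub (Hinf_cst 1) (Hinf_mul (Hinf_cst _) (Hinf_id R)). Qed.

Lemma Hinf_1B_inner : Hinf (fun z => 1 - conjc a * th z).
Proof. exact: Hinf_sub (Hinf_cst 1) (Hinf_mul (Hinf_cst _) (inner_Hinf thI)). Qed.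

Lemma inner_unimodular : aeT (fun z => normc (th z) = 1).
Proof. by have [] := (innerP th).1 thI. Qed.

Lemma Hinf_inv_1B_inner : Hinf (fun z => (1 - conjc a * th z)^-1).
Proof.
apply: (Hinf_geometric (rho := normc a)) a1 _.
  exact: H2_scale _ (inner_Hinf thI).1.
by apply: aeT_mp inner_unimodular => z _ th1; rewrite Normc.normcM normcJ th1 mulr1.
Qed.

Lemma Hinf_kker : Hinf (kker th mu).
Proof. exact: Hinf_mul Hinf_1B_inner (Hinf_inv_szego muD). Qed.

Lemma Hinf_inv_kker : Hinf (fun z => (kker th mu z)^-1).
Proof.
have := Hinf_mul (Hinf_1B_conj mu) Hinf_inv_1B_inner; congr Hinf.
by apply/funext => z; rewrite /kker invf_div.
Qed.

Lemma Hinf_ktilde : Hinf (ktilde th mu).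
Proof.
have [H2th bth] := inner_Hinf thI; split; first exact: H2_div H2th muD.
exact: bddT_mul (bddT_sub bth (bddT_cst a)) (bddT_inv_sub muD).
Qed.

Lemma inner_den_neq0 z : normc (th z) = 1 -> 1 - conjc a * th z != 0.
Proof.
move=> th1; rewrite -normc_gt0; apply: lt_le_trans (normc_1B_ge _).
by rewrite Normc.normcM th1 mulr1 normcJ subr_gt0.
Qed.

Lemma kker_neq0 z : normc z = 1 -> normc (th z) = 1 -> kker th mu z != 0.
Proof.
move=> z1 th1; apply: mulf_neq0; first exact: inner_den_neq0.
by rewrite invr_eq0; exact: szego_den_neq0.
Qed.

(** The conjugation f |-> th conj (z f) of the model space exchanges the two kernels. *)
Lemma ktilde_conj z : normc z = 1 -> normc (th z) = 1 ->
  ktilde th mu z = th z * conjc z * conjc (kker th mu z).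
Proof.
move=> z1 th1; rewrite /kker conjcM conjcV !conjcB !conjcM !conjcK conjc1.
rewrite -/a /ktilde -/a !unit_conjV//.
have z0 := unit_neq0 z1; have th0 := unit_neq0 th1.
have d0 := circle_sub_neq0 muD z1.
by field; rewrite z0 th0 d0.
Qed.

Lemma sub_inner_kker z : normc z = 1 -> normc (th z) = 1 ->
  sub_inner th mu z * kker th mu z = th z * conjc z * conjc (kker th mu z).
Proof.
by move=> z1 th1; rewrite /sub_inner divfK ?kker_neq0// ktilde_conj.
Qed.

(** By ktilde_conj numerator and denominator have the same modulus on the circle,
    and the denominator is invertible in H^oo. *)
Lemma inner_sub_inner : inner (sub_inner th mu).
Proof.
have [H2s _] := Hinf_mul Hinf_ktilde Hinf_inv_kker.
apply/innerP; split; first exact: H2s.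
apply: aeT_mp inner_unimodular => z z1 th1; rewrite /sub_inner ktilde_conj//.
have k0 : normc (kker th mu z) != 0 by rewrite normc_eq0 kker_neq0.
by rewrite !Normc.normcM Normc.normcV !normcJ th1 z1 !mul1r divff.
Qed.

Lemma ktilde_mul z : normc z = 1 -> (z - mu) * ktilde th mu z = th z - a.
Proof. by move=> z1; rewrite mulrC divfK// circle_sub_neq0. Qed.

(** With w the multiplier, conj th B_lam w = conj (w th_mu) on the circle. The real
    constant s serves both the plain and the normalised multiplier. *)
Lemma kerT_blaschke (lam : R[i]) (s : R) : disk lam -> s != 0 ->
  kerT (fun z => conjc (th z) * blaschke lam z) =
  mulset (fun z => (1 - conjc lam * z) * kker th mu z / s%:C%C) (modelK (sub_inner th mu)).
Proof.
move=> lamD s0; have sC : s%:C%C != 0 :> R[i] by rewrite fmorph_eq0.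
have mth := Hinf_measT (inner_Hinf thI).
apply: (kerT_transfer (v := fun z => (1 - conjc lam * z)^-1 * (kker th mu z)^-1 * s%:C%C)).
- apply: measT_mul (measT_conj mth) (measT_mul _ _).
  + exact: measT_sub (@measT_id R) (measT_cst lam).
  + exact: Hinf_measT (Hinf_inv_szego lamD).
- exact: measT_conj (Hinf_measT (inner_Hinf inner_sub_inner)).
- exact: Hinf_mul (Hinf_mul (Hinf_1B_conj lam) Hinf_kker) (Hinf_cst _).
- exact: Hinf_mul (Hinf_mul (Hinf_inv_szego lamD) Hinf_inv_kker) (Hinf_cst _).
- apply: aeT_mp inner_unimodular => z z1 th1.
  have k0 := kker_neq0 z1 th1; have l0 := szego_den_neq0 lamD z1.
  by field; rewrite k0 l0 sC.
- apply: aeT_mp inner_unimodular => z z1 th1.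
  have l0 := szego_den_neq0 lamD z1.
  have key : conjc (sub_inner th mu z) * conjc (kker th mu z) =
      conjc (th z) * z * kker th mu z.
    by rewrite -conjcM sub_inner_kker// !conjcM !conjcK.
  have conjE (x y : R[i]) : conjc (x * y / s%:C%C) = conjc x * conjc y / s%:C%C.
    by rewrite !conjcM conjcV conjc_real.
  have lamE : conjc (1 - conjc lam * z) = 1 - lam * conjc z.
    by rewrite conjcB conjcM conjcK conjc1.
  rewrite conjE lamE /blaschke.
  transitivity (conjc (th z) * (z - lam) * kker th mu z / s%:C%C).
    by field; rewrite sC l0.
  transitivity ((1 - lam * conjc z) * (conjc (sub_inner th mu z) * conjc (kker th mu z)) / s%:C%C);
    last by ring.
  have -> : z - lam = (1 - lam * conjc z) * z.
    by rewrite mulrBl mul1r -mulrA [conjc z * z]mulrC unit_conjc// mulr1.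
  by rewrite key; ring.
Qed.

(** The Frostman shift (th - a) / (1 - conj a th) vanishes at mu, and th_mu is what
    remains after this zero is divided out. *)
Lemma blaschke_sub_inner z : normc z = 1 -> normc (th z) = 1 ->
  blaschke mu z * sub_inner th mu z * (1 - conjc a * th z) = th z - a.
Proof.
move=> z1 th1; have d0 := circle_sub_neq0 muD z1.
have l0 := szego_den_neq0 muD z1; have t0 := inner_den_neq0 th1.
rewrite /sub_inner /ktilde /kker /blaschke -/a; field.
by rewrite d0 l0 t0.
Qed.

(** On the circle conj th (1 - conj a th) = conj (th - a), which is
    conj (1 - conj a th) conj (B_mu th_mu) by blaschke_sub_inner. *)
Lemma modelK_crofoot (s : R) : s != 0 ->
  modelK th = mulset (fun z => (1 - conjc a * th z) / s%:C%C)
    (modelK (fun z => blaschke mu z * sub_inner th mu z)).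
Proof.
move=> s0; have sC : s%:C%C != 0 :> R[i] by rewrite fmorph_eq0.
have mth := Hinf_measT (inner_Hinf thI).
have mB : measT (blaschke mu).
  apply: measT_mul (measT_sub (@measT_id R) (measT_cst mu)) _.
  exact: Hinf_measT (Hinf_inv_szego muD).
apply: (kerT_transfer (v := fun z => (1 - conjc a * th z)^-1 * s%:C%C)).
- exact: measT_conj mth.
- exact: measT_conj (measT_mul mB (Hinf_measT (inner_Hinf inner_sub_inner))).
- exact: Hinf_mul Hinf_1B_inner (Hinf_cst _).
- exact: Hinf_mul Hinf_inv_1B_inner (Hinf_cst _).
- apply: aeT_mp inner_unimodular => z z1 th1.
  have t0 := inner_den_neq0 th1.
  by field; rewrite t0 sC.
- apply: aeT_mp inner_unimodular => z z1 th1.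
  have sE : conjc (s%:C%C)^-1 = (s%:C%C)^-1 :> R[i] by rewrite conjcV conjc_real.
  transitivity (conjc (th z - a) / s%:C%C).
    by rewrite mulrA mulrBr mulr1 mulrCA [conjc (th z) * _]mulrC unit_conjc// mulr1 conjcB.
  by rewrite -(blaschke_sub_inner z1 th1) conjcM [in RHS]conjcM sE; ring.
Qed.

Lemma normT_crofoot (psi q f : R[i] -> R[i]) (s : R) : 0 < s ->
  s ^+ 2 = 1 - normc a ^+ 2 -> measT psi -> Hinf q ->
  aeT (fun z => th z - a = psi z * q z) -> modelK psi f ->
  normT (fun z => (1 - conjc a * th z) / s%:C%C * f z) = normT f.
Proof.
move=> s0 sE mpsi Hq tha Kf.
rewrite -[LHS]/(Num.sqrt (sqT _)) -[RHS]/(Num.sqrt (sqT _)); congr Num.sqrt.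
have H2f : H2 f by case/kerTE: Kf.
have L2g : L2T (fun z => (1 - conjc a * th z) * f z).
  by have [H2t bt] := Hinf_1B_inner; exact: H2_L2T (H2_mul H2t bt H2f).
rewrite (sqT_eq (g := fun z => (s%:C%C)^-1 * ((1 - conjc a * th z) * f z))); last first.
  by move=> z _; ring.
rewrite sqT_scale// (sqT_crofoot thI mpsi Hq tha Kf).
rewrite -sE Normc.normcV normcR ger0_norm ?(ltW s0)// mulrA -exprMn mulVf ?gt_eqF//.
by rewrite expr1n mul1r.
Qed.

Lemma modelK_crofoot_norm (s : R) f : 0 < s -> s ^+ 2 = 1 - normc a ^+ 2 ->
  modelK (fun z => blaschke mu z * sub_inner th mu z) f ->
  normT (fun z => (1 - conjc a * th z) / s%:C%C * f z) = normT f.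
Proof.
move=> s0 sE; apply: normT_crofoot s0 sE _ Hinf_1B_inner _.
- apply: measT_mul (Hinf_measT (inner_Hinf inner_sub_inner)).
  apply: measT_mul (measT_sub (@measT_id R) (measT_cst mu)) _.
  exact: Hinf_measT (Hinf_inv_szego muD).
- by apply: aeT_mp inner_unimodular => z z1 th1; rewrite blaschke_sub_inner.
Qed.

(** Here th - a is written as th_mu times (z - mu) kker th mu, which lies in H^oo. *)
Lemma kerT_blaschke_norm (s : R) f : 0 < s -> s ^+ 2 = 1 - normc a ^+ 2 ->
  modelK (sub_inner th mu) f ->
  normT (fun z => (1 - conjc a * th z) / s%:C%C * f z) = normT f.
Proof.
move=> s0 sE; have Hz : Hinf (fun z => z - mu) := Hinf_sub (Hinf_id R) (Hinf_cst mu).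
apply: normT_crofoot s0 sE _ (Hinf_mul Hz Hinf_kker) _.
- exact: Hinf_measT (inner_Hinf inner_sub_inner).
- apply: aeT_mp inner_unimodular => z z1 th1.
  by rewrite mulrCA /sub_inner divfK ?kker_neq0// ktilde_mul.
Qed.

End frostman_quotient.

(** * The logarithm of 1 - x *)

Section complex_logarithm.
Variable R : realType.
Implicit Types (x y z w : R[i]).

(** The principal branch, adequate because 1 - x has positive real part for |x| < 1. *)
Definition log1B x : R[i] :=
  Complex (ln (normc (1 - x))) (atan (complex.Im (1 - x) / complex.Re (1 - x))).

Lemma cexpD x y : cexp (x + y) = cexp x * cexp y.
Proof.
case: x => a b; case: y => c d; rewrite /cexp /= expRD expi_addr rmorphM/=; ring.
Qed.

Lemma cexp_real (t : R) : cexp t%:C%C = (expR t)%:C%C.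
Proof. by rewrite /cexp /expi /= cos0 sin0 mulr1. Qed.

Lemma normc_cexp x : normc (cexp x) = expR (complex.Re x).
Proof.
by rewrite /cexp Normc.normcM normc_expi mulr1 normcR ger0_norm ?expR_ge0.
Qed.

Lemma Re1B_gt0 x : normc x < 1 -> 0 < complex.Re (1 - x).
Proof.
move=> x1; have -> : complex.Re (1 - x) = 1 - complex.Re x by case: x {x1}.
rewrite subr_gt0; apply: le_lt_trans x1; apply: le_trans (Re_le_normc x).
exact: ler_norm.
Qed.

Lemma cexp_log1B x : normc x < 1 -> cexp (log1B x) = 1 - x.
Proof.
move=> /Re1B_gt0; rewrite /log1B; case: (1 - x) => p q /= p0.
have n0 : 0 < normc (p +i* q)%C.
  by rewrite normc_gt0; apply/eqP => -[/eqP]; rewrite gt_eqF.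
have nE : normc (p +i* q)%C = p * Num.sqrt (1 + (q / p) ^+ 2).
  transitivity (Num.sqrt (p ^+ 2) * Num.sqrt (1 + (q / p) ^+ 2)).
    by rewrite -sqrtrM ?sqr_ge0// /normc; congr Num.sqrt; field; rewrite gt_eqF.
  by rewrite sqrtr_sqr ger0_norm// ltW.
have s0 : Num.sqrt (1 + (q / p) ^+ 2) != 0.
  by move: n0; rewrite nE; apply: contraTneq => ->; rewrite mulr0 ltxx.
have co : cos (atan (q / p)) = (Num.sqrt (1 + (q / p) ^+ 2))^-1 by rewrite cos_atan.
have c0 : cos (atan (q / p)) != 0 by rewrite co invr_eq0.
have si : sin (atan (q / p)) = q / p * cos (atan (q / p)).
  by rewrite -{2}(atanK (q / p)) /tan divfK.
rewrite /cexp /= lnK ?posrE// /expi si co nE.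
apply: complex_eq; rewrite ?Re_mul ?Im_mul /=; field; rewrite ?s0 ?gt_eqF//.
Qed.

Lemma is_derive_ext (f g : R -> R) (t d d' : R) : (forall s, f s = g s) ->
  is_derive t 1 f d -> d = d' -> is_derive t 1 g d'.
Proof. by move=> /funext <- D <-. Qed.

Lemma is_derive_psum (c : nat -> R) N (t : R) :
  is_derive t 1 (fun s => \sum_(k < N) (c k / k.+1%:R) * s ^+ k.+1)
    (\sum_(k < N) c k * t ^+ k).
Proof.
elim: N => [|N IH].
  apply: is_derive_ext (is_derive_cst (0 : R) t 1) _ => [s|]; by rewrite big_ord0.
have D := is_deriveD IH
  (is_deriveZ (c N / N.+1%:R) (is_deriveX N.+1 (is_derive_id t (1 : R)))).
apply: is_derive_ext D _ => [s|]; rewrite big_ord_recr//=; congr (_ + _).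
  by rewrite /GRing.scale/= exprfctE.
rewrite /GRing.scale/= mulr1 mulrA; congr (_ * _).
by rewrite divfK// pnatr_eq0.
Qed.

Lemma MVT01_le (f df : R -> R) (M : R) :
  (forall t : R, 0 <= t <= 1 -> is_derive t 1 f (df t)) ->
  (forall t : R, 0 <= t <= 1 -> `|df t| <= M) -> `|f 1 - f 0| <= M.
Proof.
move=> fd dfM.
have c01 : {within `[(0 : R), 1], continuous f}.
  apply: derivable_within_continuous => t; rewrite in_itv/= => t01.
  by have [] := fd t t01.
have [|c] := MVT (df := df) ltr01 _ c01.
  move=> t; rewrite in_itv/= => /andP[t0 t1]; apply: fd.
  by rewrite (ltW t0) (ltW t1).
rewrite in_itv/= => /andP[c0 c1] ->; rewrite subr0 mulr1; apply: dfM.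
by rewrite (ltW c0) (ltW c1).
Qed.

(** Along the segment from 0 to x the derivative of log (1 - t x) is - x / (1 - t x),
    a geometric series whose remainder is explicit. *)
Lemma log1B_deriv_remainder x (t : R) N : 1 - t%:C%C * x != 0 ->
  - x / (1 - t%:C%C * x) + \sum_(k < N) x ^+ k.+1 * t%:C%C ^+ k =
  - (x * (t%:C%C * x) ^+ N / (1 - t%:C%C * x)).
Proof.
move=> nz; have -> : \sum_(k < N) x ^+ k.+1 * t%:C%C ^+ k =
    x * \sum_(k < N) (t%:C%C * x) ^+ k.
  by rewrite mulr_sumr; apply: eq_bigr => k _; rewrite exprMn exprS; ring.
rewrite sum_geometric; last by rewrite eq_sym -subr_eq0.
by field.
Qed.

Lemma log1B_deriv_bound x (t rho : R) N : normc x <= rho -> rho < 1 -> 0 <= t <= 1 ->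
  normc (- (x * (t%:C%C * x) ^+ N / (1 - t%:C%C * x))) <= rho ^+ N * (1 - rho)^-1.
Proof.
move=> xr r1 /andP[t0 t1]; have x0 := normc_ge0 x.
have tx : normc (t%:C%C * x) <= rho.
  by rewrite Normc.normcM normcR ger0_norm//; apply: le_trans xr; rewrite ler_piMl.
have d : 1 - rho <= normc (1 - t%:C%C * x).
  by apply: le_trans (normc_1B_ge _); rewrite lerD2l lerN2.
have d0 : 0 < normc (1 - t%:C%C * x) by apply: lt_le_trans d; rewrite subr_gt0.
have r0 : 0 <= rho := le_trans x0 xr.
rewrite normcN !Normc.normcM Normc.normcV; apply: ler_pM.
- by rewrite mulr_ge0 ?normc_ge0.
- by rewrite invr_ge0 normc_ge0.
- rewrite -[leRHS]mul1r normcX; apply: ler_pM => //.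
  + by rewrite exprn_ge0// normc_ge0.
  + exact: le_trans xr (ltW r1).
  + by rewrite lerXn2r ?nnegrE ?normc_ge0.
- by rewrite lef_pV2 ?posrE ?subr_gt0.
Qed.

Lemma Re_sum (I : Type) (r : seq I) (P : pred I) (F : I -> R[i]) :
  complex.Re (\sum_(i <- r | P i) F i) = \sum_(i <- r | P i) complex.Re (F i).
Proof. by elim/big_ind2 : _ => // x1 x2 y1 y2 <- <-; rewrite Re_add. Qed.

Lemma Im_sum (I : Type) (r : seq I) (P : pred I) (F : I -> R[i]) :
  complex.Im (\sum_(i <- r | P i) F i) = \sum_(i <- r | P i) complex.Im (F i).
Proof. by elim/big_ind2 : _ => // x1 x2 y1 y2 <- <-; rewrite Im_add. Qed.

Lemma Re_mulR x (t : R) : complex.Re (x * t%:C%C) = complex.Re x * t.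
Proof. by case: x => a b /=; rewrite mulr0 subr0. Qed.

Lemma Im_mulR x (t : R) : complex.Im (x * t%:C%C) = complex.Im x * t.
Proof. by case: x => a b /=; rewrite mulr0 add0r. Qed.

(** The Taylor polynomial of log (1 - x); its constant term is 0 because 0^-1 = 0. *)
Definition log1B_poly N : {poly R[i]} := \poly_(k < N.+1) (- (k%:R)^-1).

Lemma horner_log1B_poly N x :
  (log1B_poly N).[x] = - \sum_(k < N) x ^+ k.+1 * ((k.+1%:R)^-1)%:C%C.
Proof.
rewrite /log1B_poly horner_poly big_ord_recl/= invr0 oppr0 mul0r add0r -sumrN.
apply: eq_bigr => k _; rewrite mulNr mulrC /bump/= add1n; congr (- (_ * _)).
by rewrite fmorphV rmorph_nat.
Qed.

(** The mean value theorem on [0, 1], for real and imaginary parts separately, applied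
    to the difference of log (1 - t x) and its Taylor polynomial; hence the factor 2. *)
Lemma log1B_approx x (rho : R) N : normc x <= rho -> rho < 1 ->
  normc (log1B x - (log1B_poly N).[x]) <= 2 * (rho ^+ N * (1 - rho)^-1).
Proof.
move=> xr r1; set M := rho ^+ N * _.
have x1 : normc x < 1 by exact: le_lt_trans r1.
have tx1 (t : R) : 0 <= t <= 1 -> normc (t%:C%C * x) < 1.
  move=> /andP[t0 t1]; rewrite Normc.normcM normcR ger0_norm//.
  by apply: le_lt_trans x1; rewrite ler_piMl ?normc_ge0.
pose p (t : R) : R := complex.Re (1 - t%:C%C * x).
pose q (t : R) : R := complex.Im (1 - t%:C%C * x).
pose al := complex.Re x; pose be := complex.Im x.
have pE t : p t = 1 - al * t by rewrite /p /al; case: (x) => a b /=; ring.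
have qE t : q t = - be * t by rewrite /q /be; case: (x) => a b /=; ring.
have p0 (t : R) : 0 <= t <= 1 -> 0 < p t by move=> /tx1; exact: Re1B_gt0.
have nz (t : R) : 0 <= t <= 1 -> 1 - t%:C%C * x != 0.
  by move=> /p0; apply: contraTneq => h; rewrite /p h /= ltxx.
have D0 (t : R) : 0 <= t <= 1 -> 0 < p t ^+ 2 + q t ^+ 2.
  by move=> /p0 pt; rewrite ltr_pwDl ?sqr_ge0// exprn_gt0.
have dlin (k m t : R) : is_derive t 1 (fun s => k + m * s) m.
  have D := is_deriveD (is_derive_cst k t (1 : R)) (is_deriveZ m (is_derive_id t (1 : R))).
  by apply: is_derive_ext D _ => //; rewrite add0r /GRing.scale/= mulr1.
have dp (t : R) : is_derive t 1 p (- al).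
  by apply: is_derive_ext (dlin 1 (- al) t) _ => // s; rewrite pE mulNr.
have dq (t : R) : is_derive t 1 q (- be).
  by apply: is_derive_ext (dlin 0 (- be) t) _ => // s; rewrite qE add0r.
have quot (t : R) : 0 <= t <= 1 -> - x / (1 - t%:C%C * x) =
    Complex ((- al * p t - be * q t) / (p t ^+ 2 + q t ^+ 2))
            ((- be * p t + al * q t) / (p t ^+ 2 + q t ^+ 2)).
  move=> t01; have := D0 t t01; have := nz t t01; rewrite /p /q /al /be.
  case: (1 - t%:C%C * x) => a b nzab /= D.
  apply: (mulIf nzab); rewrite divfK//; case: (x) => c d.
  by apply: complex_eq => /=; field; rewrite gt_eqF.
have Reb : `|complex.Re (log1B x - (log1B_poly N).[x])| <= M.
  pose f (t : R) := 2^-1 * ln (p t ^+ 2 + q t ^+ 2) +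
    \sum_(k < N) (complex.Re (x ^+ k.+1) / k.+1%:R) * t ^+ k.+1.
  have fE : complex.Re (log1B x - (log1B_poly N).[x]) = f 1 - f 0.
    have f0 : f 0 = 0.
      rewrite /f pE qE !mulr0 subr0 expr1n expr0n/= addr0 ln1 mulr0 add0r.
      by apply: big1 => k _; rewrite expr0n/= mulr0.
    rewrite f0 subr0 horner_log1B_poly opprK Re_add Re_sum; congr (_ + _); last first.
      by apply: eq_bigr => k _; rewrite Re_mulR expr1n mulr1.
    have n0 : 0 < normc (1 - x) by rewrite normc_gt0 -[x]mul1r; apply: (nz 1); rewrite ler01 lexx.
    rewrite /p /q mul1r -normc_sqr lnXn// -[LHS]/(ln (normc (1 - x))); lra.
  rewrite fE; apply: (MVT01_le (df := fun t =>
    complex.Re (- (x * (t%:C%C * x) ^+ N / (1 - t%:C%C * x))))).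
    move=> t t01; have Dt := D0 t t01.
    have dD := is_deriveD (is_deriveX 2 (dp t)) (is_deriveX 2 (dq t)).
    have dD' : is_derive t 1 (fun s => p s ^+ 2 + q s ^+ 2) (- 2 * (al * p t + be * q t)).
      apply: is_derive_ext dD _ => [s|]; first by rewrite -[LHS]/((p ^+ 2) s + (q ^+ 2) s) !exprfctE.
      rewrite /GRing.scale/= !expr1; ring.
    have dln := is_derive1_comp (g := fun s => p s ^+ 2 + q s ^+ 2) (is_derive1_ln Dt) dD'.
    have D := is_deriveD (is_deriveZ 2^-1 dln)
      (is_derive_psum (fun k => complex.Re (x ^+ k.+1)) N t).
    apply: is_derive_ext D _ => //.
    rewrite -log1B_deriv_remainder ?nz// Re_add Re_sum quot//=; congr (_ + _).
      rewrite /GRing.scale/=; have Dn : p t ^+ 2 + q t ^+ 2 != 0 by rewrite gt_eqF.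
      move: (p t) (q t) Dn => a b ab; by field.
    by apply: eq_bigr => k _; rewrite -rmorphXn Re_mulR.
  move=> t t01; apply: le_trans (Re_le_normc _) _; exact: log1B_deriv_bound.
have Imb : `|complex.Im (log1B x - (log1B_poly N).[x])| <= M.
  pose f (t : R) := atan (q t / p t) +
    \sum_(k < N) (complex.Im (x ^+ k.+1) / k.+1%:R) * t ^+ k.+1.
  have fE : complex.Im (log1B x - (log1B_poly N).[x]) = f 1 - f 0.
    have f0 : f 0 = 0.
      rewrite /f qE !mulr0 mul0r atan0 add0r.
      by apply: big1 => k _; rewrite expr0n/= mulr0.
    rewrite f0 subr0 horner_log1B_poly opprK Im_add Im_sum; congr (_ + _); last first.
      by apply: eq_bigr => k _; rewrite Im_mulR expr1n mulr1.
    by rewrite /p /q mul1r.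
  rewrite fE; apply: (MVT01_le (df := fun t =>
    complex.Im (- (x * (t%:C%C * x) ^+ N / (1 - t%:C%C * x))))).
    move=> t t01; have Dt := D0 t t01; have pt := p0 t t01.
    have pn : p t != 0 by rewrite gt_eqF.
    have dV := is_deriveM (dq t) (is_deriveV pn (dp t)).
    have datan := is_derive1_comp (g := fun s => q s / p s) (is_derive1_atan (q t / p t)) dV.
    have D := is_deriveD datan
      (is_derive_psum (fun k => complex.Im (x ^+ k.+1)) N t).
    apply: is_derive_ext D _ => //.
    rewrite -log1B_deriv_remainder ?nz// Im_add Im_sum quot//=; congr (_ + _).
      rewrite /GRing.scale/=; have Dn : p t ^+ 2 + q t ^+ 2 != 0 by rewrite gt_eqF.
      by move: (p t) (q t) pn Dn => a b a0 ab; field; rewrite a0 ab.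
    by apply: eq_bigr => k _; rewrite -rmorphXn Im_mulR.
  move=> t t01; apply: le_trans (Im_le_normc _) _; exact: log1B_deriv_bound.
apply: le_trans (normc_le_ReIm _) _; lra.
Qed.

End complex_logarithm.

(** * Outer functions *)

Section outer_functions.
Variable R : realType.
Implicit Types (f g u : R[i] -> R[i]) (z w : R[i]).

Lemma measurable_normc f : measT f ->
  measurable_fun (arc R) (fun t => normc (f (expi t))).
Proof.
move=> mf; have msqrt : measurable_fun [set: R] (@Num.sqrt R).
  by apply: continuous_measurable_fun; exact: sqrt_continuous.
apply: (eq_measurable_fun (fun t => Num.sqrt (normc (f (expi t)) ^+ 2))).
  by move=> t _; rewrite sqrtr_sqr ger0_norm// normc_ge0.
by apply: (measurableT_comp msqrt); exact: measurable_normc_sqr mf.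
Qed.

Lemma H2_log1B f (rho : R) : H2 f -> rho < 1 -> aeT (fun z => normc (f z) <= rho) ->
  [/\ H2 (fun z => log1B (f z)), bddT (fun z => log1B (f z)) &
      forall z, disk z -> hval (fun w => log1B (f w)) z = log1B (hval f z)].
Proof.
move=> H2f rho1 frho; pose r := Num.max rho 0.
have r0 : 0 <= r by rewrite le_max lexx orbT.
have r1 : r < 1 by rewrite gt_max rho1 ltr01.
have fr : aeT (fun z => normc (f z) <= r).
  by apply: aeT_mp frho => z _ h; rewrite le_max h.
have u0 : (fun N => 2 * (r ^+ N * (1 - r)^-1)) @ \oo --> (0 : R).
  rewrite -(mulr0 2); apply: cvgMr.
  rewrite -(mul0r (1 - r)^-1); apply: cvgMl; apply: null_expr; by rewrite r0.
have m1 : measT (fun z => 1 - f z) := measT_sub (measT_cst 1) (H2_measT H2f).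
have mA : measT (fun z => log1B (f z)).
  have [mp mq] := m1; split => /=.
  - apply: (measurableT_comp (@measurable_ln R)).
    exact: measurable_normc m1.
  - have matan : measurable_fun [set: R] (@atan R).
      by apply: continuous_measurable_fun; exact: continuous_atan.
    apply: (measurableT_comp matan).
    apply: measurable_funM => //.
    apply: (eq_measurable_fun (fun t => complex.Re (1 - f (expi t)) *
      (complex.Re (1 - f (expi t)) ^+ 2)^-1)).
      move=> t _; have [->|nz] := eqVneq (complex.Re (1 - f (expi t))) 0.
        by rewrite mul0r invr0.
      by move: (complex.Re _) nz => s nz; field.
    apply: measurable_funM => //; apply: measurable_inv; last exact: measurable_funX.
    by move=> t _; exact: sqr_ge0.
exact: (H2_comp r0 u0 (fun n x xr => log1B_approx n xr r1) H2f fr mA).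
Qed.

(** On the circle (w + z) / (w - z) = 2 conj (szego z w) - 1. Its integral against g is
    2 g(z) - g(0), and its integral against conj g is conj (g(0)). *)
Lemma herglotz g z : H2 g -> disk z ->
  intT (fun w => (w + z) / (w - z) * (complex.Re (g w))%:C%C) =
  hval g z - Complex 0 (complex.Im (hval g 0)).
Proof.
move=> H2g zD; have L2g := H2_L2T H2g; have H2k := H2_szego zD.
have L2k := H2_L2T H2k.
have D0 : disk (0 : R[i]) by rewrite /disk Normc.normc0 ltr01.
have kb : bddT (szego z).
  by apply: (bddT_le (M := (1 - normc z)^-1)); apply: aeT_all => w; exact: szego_bound.
have szego0 w : szego 0 w = 1 by rewrite /szego conjc0 mul0r subr0 invr1.
have int0 f : H2 f -> intT f = hval f 0.
  move=> H2f; rewrite hval_hev//; apply: intT_eq => w _.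
  by rewrite szego0 conjc1 mulr1.
have L1g : L1T g.
  have := L1T_mul (L2T_cst 1) L2g; congr L1T.
  by apply/funext => w; rewrite mul1r.
have H2kg := H2_mul H2k kb H2g.
have k0 : hval (szego z) 0 = 1.
  rewrite -(int0 _ H2k) -[RHS]conjc1 -(hval_cst 1 zD) (hval_hev (H2_cst _) zD).
  rewrite /hev /innerT -intT_conj; last by apply: L1T_ip L2k; exact: L2T_cst.
  by apply: intT_eq => w _; rewrite mul1r conjcK.
pose I1 w := g w * conjc (szego z w).
pose I2 w := szego z w * g w.
have L1I1 : L1T I1 := L1T_ip L2g L2k.
have L1I2 : L1T I2 := L1T_mul L2k L2g.
have i1 : intT I1 = hval g z by rewrite (hval_hev H2g zD).
have i2 : intT I2 = hval g 0.
  by rewrite (int0 _ H2kg) (hvalM H2k kb H2g D0) k0 mul1r.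
have i0 : intT g = hval g 0 := int0 _ H2g.
pose S w := (I1 w + - 2^-1 * g w) + (conjc (I2 w) + - 2^-1 * conjc (g w)).
transitivity (intT S).
  apply: intT_eq => w w1; have wz := circle_sub_neq0 zD w1.
  have kz := szego_den_neq0 zD w1.
  have kE : conjc (szego z w) = w / (w - z).
    rewrite /szego conjcV conjcB conjcM conjcK conjc1 unit_conjV//.
    have w0 := unit_neq0 w1; have : 1 - z * w^-1 != 0.
      apply: contraNneq wz => h; have -> : w - z = (1 - z * w^-1) * w by field.
      by rewrite h mul0r.
    by move=> nz; field; rewrite w0 wz.
  rewrite ReJ_add /S /I1 /I2 conjcM kE; field.
  by rewrite wz.
have L1gc := L1T_conj L1g; have L1I2c := L1T_conj L1I2.
rewrite /S intT_add; [|exact: L1T_add L1I1 (L1T_scale _ L1g)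
                      |exact: L1T_add L1I2c (L1T_scale _ L1gc)].
rewrite (intT_add L1I1 (L1T_scale _ L1g)) (intT_add L1I2c (L1T_scale _ L1gc)).
rewrite (intT_scale _ L1g) (intT_scale _ L1gc) (intT_conj L1I2) (intT_conj L1g).
rewrite i1 i2 i0; case: (hval g 0) => a b; case: (hval g z) => c d.
by apply: complex_eq; rewrite !(Re_add, Im_add, Re_mul, Im_mul) /=; field.
Qed.

(** By herglotz the Schwarz integral of log |u| = Re g is g up to an imaginary
    constant. *)
Lemma outer_cexp g u : H2 u -> H2 g -> eqT u (fun z => cexp (g z)) ->
  (forall z, disk z -> hval u z = cexp (hval g z)) -> outer u.
Proof.
move=> H2u H2g ug hug; have mu := H2_measT H2u; have mg := H2_measT H2g.
have lnu : aeT (fun z => ln (normc (u z)) = complex.Re (g z)).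
  by apply: aeT_mp (eqT_aeT ug) => z _ ->; rewrite normc_cexp expRK.
have mln : measurable_fun (arc R) (fun t => ln (normc (u (expi t)))).
  apply: (measurableT_comp (@measurable_ln R)); exact: measurable_normc mu.
split => //.
- have mabs : measurable_fun (arc R) (fun t => `|ln (normc (u (expi t)))|).
    exact: measurableT_comp mln.
  have [_ i_g] := H2_L2T H2g.
  have k0 t : 0 <= normc (g (expi t)) ^+ 2 + 1 by rewrite addr_ge0// sqr_ge0.
  have le_k : {ae lebesgue_measure, forall t : R, arc R t ->
      `|ln (normc (u (expi t)))| <= 1 * (normc (g (expi t)) ^+ 2 + 1)}.
    apply: (@filterS _ _ (ae_filter_ringOfSetsType _)) lnu => t lnu tA.
    rewrite mul1r lnu//; apply: le_trans (Re_le_normc _) _.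
    set n := normc _; have := sqr_ge0 (n - 1); have := sqr_ge0 n; lra.
  have [i_abs _] := meanT_dominated mabs (intgD i_g (intg_cst 1))
    (fun=> normr_ge0 _) k0 ler01 le_k.
  by apply: intg_dominated mln i_abs _.
- have D0 : disk (0 : R[i]) by rewrite /disk Normc.normc0 ltr01.
  exists (expi (complex.Im (hval g 0))); split; first exact: normc_expi.
  move=> z zD; rewrite (hug z zD).
  have -> : intT (fun w => (w + z) / (w - z) * (ln (normc (u w)))%:C%C) =
      intT (fun w => (w + z) / (w - z) * (complex.Re (g w))%:C%C).
    have mq : measT (fun w => (w + z) / (w - z)).
      exact: measT_div (measT_add (@measT_id R) (measT_cst z)) (measT_sub (@measT_id R) (measT_cst z)).
    apply: intT_ae.
    + apply: measT_mul mq _; exact: measT_real mln _ (fun t _ => erefl).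
    + apply: measT_mul mq _; exact: measT_real mg.1 _ (fun t _ => erefl).
    + by apply: eqT_mp lnu => w _ ->.
  rewrite (herglotz H2g zD); set y := complex.Im _.
  have -> : expi y = cexp (Complex 0 y).
    by rewrite /cexp /= expR0 mul1r.
  by rewrite -cexpD; congr cexp; ring.
Qed.

(** Each factor is the exponential of its log1B, which lies in H^2. *)
Lemma outer_prod_1B f1 f2 (r1 r2 c : R) u : 0 < c ->
  H2 f1 -> H2 f2 -> r1 < 1 -> r2 < 1 ->
  aeT (fun z => normc (f1 z) <= r1) -> aeT (fun z => normc (f2 z) <= r2) ->
  measT u -> eqT u (fun z => c%:C%C * ((1 - f1 z) * (1 - f2 z))) -> outer u.
Proof.
move=> c0 H2f1 H2f2 r11 r21 b1 b2 mu uE.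
have [L1 _ hL1] := H2_log1B H2f1 r11 b1; have [L2 _ hL2] := H2_log1B H2f2 r21 b2.
have C1 := H2_cst (1 : R[i]).
have H1 := H2_sub C1 H2f1; have H2' := H2_sub C1 H2f2.
have bb1 : bddT (fun z => 1 - f1 z).
  exact: bddT_sub (bddT_cst 1) (bddT_le b1).
have H12 := H2_mul H1 bb1 H2'.
have Hp := H2_scale c%:C%C H12.
have up : eqT (fun z => c%:C%C * ((1 - f1 z) * (1 - f2 z))) u.
  by apply: eqT_mp (eqT_aeT uE) => z _ ->.
have H2u := H2_eqT mu up Hp.
have L12 := H2_add L1 L2.
have Hg := H2_add L12 (H2_cst (ln c)%:C%C).
have small f (r : R) z : H2 f -> r < 1 -> aeT (fun w => normc (f w) <= r) -> disk z ->
    normc (hval f z) < 1.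
  move=> H2f rl fr zD; apply: (@le_lt_trans _ _ (Num.max r 0)); last by rewrite gt_max rl ltr01.
  apply: (hval_le H2f _ _ zD); first by rewrite le_max lexx orbT.
  by apply: aeT_mp fr => w _ h; rewrite le_max h.
apply: (outer_cexp H2u Hg).
- apply: eqT_mp (aeT_and (eqT_aeT uE) (aeT_and b1 b2)) => z _ [-> [h1 h2]].
  rewrite !cexpD cexp_real lnK ?posrE// !cexp_log1B; [ring|exact: le_lt_trans h2 _|].
  exact: le_lt_trans h1 _.
- move=> z zD; rewrite (hval_eqT Hp mu up zD) (hvalZ _ H12 zD) (hvalM H1 bb1 H2' zD).
  rewrite (hvalB C1 H2f1 zD) (hvalB C1 H2f2 zD) (hval_cst 1 zD).
  rewrite (hvalD L12 (H2_cst _) zD) (hvalD L1 L2 zD) (hval_cst _ zD) (hL1 z zD) (hL2 z zD).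
  have := small _ _ z H2f1 r11 b1 zD; have := small _ _ z H2f2 r21 b2 zD.
  move: (hval f1 z) (hval f2 z) => x y y1 x1.
  by rewrite !cexpD cexp_real lnK ?posrE// !cexp_log1B//; ring.
Qed.

End outer_functions.

(** * Isometric multipliers and the kernel *)

Section multipliers.
Variable R : realType.
Implicit Types (f g h m u th : R[i] -> R[i]) (A B C : set (R[i] -> R[i])) (z : R[i]).

Lemma kerT_measT g f : kerT g f -> measT f.
Proof. by move=> [/H2_measT]. Qed.

Lemma normT_eq f g : (forall z, normc z = 1 -> f z = g z) -> normT f = normT g.
Proof. by move=> /sqT_eq fg; congr Num.sqrt; exact: fg. Qed.

Lemma isometric_multiplier_mulset m A B : measT m -> (forall f, A f -> measT f) ->
  B = mulset m A -> (forall f, A f -> normT (fun z => m z * f z) = normT f) ->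
  isometric_multiplier m A B.
Proof.
move=> mm mA -> iso; split => // [f Af|g [_ //]]; split.
  exact: measT_mul mm (mA _ Af).
by exists f => //; exact: eqT_refl.
Qed.

Lemma mulset_comp m u A : measT u -> (forall f, A f -> measT f) ->
  mulset m (mulset u A) = mulset (fun z => m z * u z) A.
Proof.
move=> mu mA; apply/seteqP; split => g.
- move=> [mg [h [mh [f Af hf]] gh]]; split => //; exists f => //.
  by apply: eqT_mp (aeT_and (eqT_aeT gh) (eqT_aeT hf)) => z _ [-> ->]; rewrite mulrA.
- move=> [mg [f Af gf]]; split => //; exists (fun z => u z * f z).
    split; first exact: measT_mul mu (mA _ Af).
    by exists f => //; exact: eqT_refl.
  by apply: eqT_mp (eqT_aeT gf) => z _ ->; rewrite mulrA.
Qed.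

Lemma modelK_combination th f g (c d : R[i]) : inner th -> modelK th f -> modelK th g ->
  modelK th (fun z => c * f z + d * g z).
Proof.
move=> thI /kerTE[H2f hf] /kerTE[H2g hg]; have [H2t bt] := inner_Hinf thI.
apply/kerTE; split; first exact: H2_add (H2_scale c H2f) (H2_scale d H2g).
move=> q H2q; have L2tq := H2_L2T (H2_mul H2t bt H2q).
have L2f := H2_L2T H2f; have L2g := H2_L2T H2g.
rewrite innerT_mulr (innerTDl (L2T_scale c L2f) (L2T_scale d L2g) L2tq).
rewrite (innerTZl c L2f L2tq) (innerTZl d L2g L2tq) -!innerT_mulr.
by rewrite (hf _ H2q) (hg _ H2q) !mulr0 addr0.
Qed.

(** Two free coefficients against one linear condition. *)
Lemma modelK_vanishing th (lam : R[i]) : inner th -> disk lam -> dim_gt 1 (modelK th) ->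
  exists g, [/\ modelK th g, hval g lam = 0 & ~ eqT g (fun=> 0)].
Proof.
move=> thI lamD [v [Kv free]].
pose f := v ord0; pose g := v ord_max.
have solve (x y : R[i]) : exists c d : R[i], (c != 0) || (d != 0) /\ c * x + d * y = 0.
  have [->|x0] := eqVneq x 0.
    by exists 1, 0; rewrite oner_eq0 mulr0 mul0r addr0.
  exists y, (- x); rewrite oppr_eq0 x0 orbT; split => //.
  by rewrite mulNr mulrC subrr.
have [c [d [cd0 cdv]]] := solve (hval f lam) (hval g lam).
have Kf : modelK th f by exact: Kv.
have Kg : modelK th g by exact: Kv.
exists (fun z => c * f z + d * g z); split.
- exact: modelK_combination.
- have [[H2f _] [H2g _]] := (Kf, Kg).
  by rewrite (hvalD (H2_scale c H2f) (H2_scale d H2g) lamD) (hvalZ _ H2f lamD) (hvalZ _ H2g lamD).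
- move=> z0; pose e (i : 'I_2) : R[i] := if i == ord0 then c else d.
  have e0 : forall i, e i = 0.
    apply: free; apply: eqT_mp (eqT_aeT z0) => z _ h; rewrite -[RHS]h.
    rewrite 2!big_ord_recl big_ord0 addr0 /e /=; congr (_ + _ * v _ z).
    exact: val_inj.
  by move: cd0; rewrite (e0 ord0 : c = 0) (e0 ord_max : d = 0) eqxx.
Qed.

(** The function g / B_lam lies in H^2 because the zero of B_lam cancels, and it is
    in the kernel because g is in the model space. *)
Lemma kerT_blaschke_div th g (lam : R[i]) : inner th -> disk lam -> modelK th g ->
  hval g lam = 0 -> ~ eqT g (fun=> 0) ->
  exists2 f, kerT (fun z => conjc (th z) * blaschke lam z) f & ~ eqT f (fun=> 0).
Proof.
move=> thI lamD /kerTE[H2g hg] g0 gn0.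
have [H2l bl] := Hinf_1B_conj lam.
exists (fun z => (1 - conjc lam * z) * ((g z - hval g lam) / (z - lam))).
- apply/kerTE; split; first exact: H2_mul H2l bl (H2_div H2g lamD).
  move=> q H2q; rewrite -(hg q H2q); apply: innerT_eq => // z z1.
  have l0 := szego_den_neq0 lamD z1; have z0 := circle_sub_neq0 lamD z1.
  rewrite g0 subr0 /blaschke; move: (g z) (th z) => x y.
  by field; rewrite l0 z0.
- move=> f0; apply: gn0; apply: eqT_mp (eqT_aeT f0) => z z1.
  have l0 := szego_den_neq0 lamD z1; have z0 := circle_sub_neq0 lamD z1.
  rewrite g0 subr0 => /eqP; rewrite !mulf_eq0 invr_eq0 (negbTE l0) (negbTE z0) orbF.
  by move/eqP.
Qed.

End multipliers.

Theorem theorem5p1 (R : realType) (lam : R[i]) (th : R[i] -> R[i])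
    (hlam : disk lam) (hth : inner th) (hdim : dim_gt 1 (modelK th)) :
  let symb := fun z => conjc (th z) * blaschke lam z in
  let th_ := fun mu : R[i] => sub_inner th mu in
  (forall mu : R[i], disk mu ->
     kerT symb =
     mulset (fun z => (1 - conjc lam * z) * kker th mu z) (modelK (th_ mu))) /\
  (kerT symb = mulset (m_mult lam th) (modelK (th_ lam)) /\
   isometric_multiplier (m_mult lam th) (modelK (th_ lam)) (kerT symb)) /\
  hayashi_rep symb
    (fun z => m_mult lam th z *
       (kker (th_ lam) 0 z /
        (Num.sqrt (1 - Normc.normc (hval (th_ lam) 0) ^+ 2))%:C%C))
    (sub_inner (th_ lam) 0).
Proof.
move=> symb th_.
have [g [Kg g0 gn0]] := modelK_vanishing hth hlam hdim.
have lt1 mu : disk mu -> normc (hval th mu) < 1 by exact: hval_inner_lt1 hth Kg gn0.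
have [f Kf fn0] := kerT_blaschke_div hth hlam Kg g0 gn0.
have a1 := lt1 lam hlam.
have sqrt_pos (x : R) : 0 <= x -> x < 1 ->
    0 < Num.sqrt (1 - x ^+ 2) /\ Num.sqrt (1 - x ^+ 2) ^+ 2 = 1 - x ^+ 2.
  move=> x0 x1; have x2 : 0 < 1 - x ^+ 2 by rewrite subr_gt0 expr_lt1.
  by rewrite sqrtr_gt0 x2 sqr_sqrtr// ltW.
have [] := sqrt_pos _ (normc_ge0 _) a1; set s := Num.sqrt _ => s0 sE.
have s_neq0 : s != 0 by rewrite gt_eqF.
pose a := hval th lam; pose phi := th_ lam.
have phiI : inner phi by exact: inner_sub_inner.
have Kmeas h : modelK phi h -> measT h by exact: kerT_measT.
have kerE : kerT symb = mulset (m_mult lam th) (modelK phi).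
  exact: (kerT_blaschke hth hlam a1 hlam s_neq0).
have mE z : normc z = 1 -> m_mult lam th z = (1 - conjc a * th z) / s%:C%C.
  move=> z1; have l0 := szego_den_neq0 hlam z1.
  by rewrite /m_mult /kker mulrCA divff// mulr1.
have mm : measT (m_mult lam th).
  apply: (measT_eq (f := fun z => (1 - conjc a * th z) / s%:C%C)) => [z /mE //|].
  exact: Hinf_measT (Hinf_mul (Hinf_1B_inner lam hth) (Hinf_cst _)).
have miso h : modelK phi h -> normT (fun z => m_mult lam th z * h z) = normT h.
  move=> Kh; rewrite -(kerT_blaschke_norm hth hlam a1 s0 sE Kh).
  by apply: normT_eq => z /mE ->.
have mIM := isometric_multiplier_mulset mm Kmeas kerE miso.
(* The kernel is nonzero, hence so is K_phi, so that phi is not constant. *)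
have b1 : normc (hval phi 0) < 1.
  have D0 : disk (0 : R[i]) by rewrite /disk Normc.normc0 ltr01.
  have [h Kh fh] : exists2 h, modelK phi h & eqT f (fun z => m_mult lam th z * h z).
    by move: Kf; rewrite -/symb kerE => -[].
  apply: (hval_inner_lt1 phiI Kh _ D0) => h0; apply: fn0.
  by apply: eqT_mp (aeT_and (eqT_aeT fh) (eqT_aeT h0)) => z _ [-> ->]; rewrite mulr0.
have D0 : disk (0 : R[i]) by rewrite /disk Normc.normc0 ltr01.
have [] := sqrt_pos _ (normc_ge0 _) b1; set t := Num.sqrt _ => t0 tE.
have t_neq0 : t != 0 by rewrite gt_eqF.
pose b := hval phi 0; pose gam := sub_inner phi 0.
pose v z := kker phi 0 z / t%:C%C.
have vE : v = fun z => (1 - conjc b * phi z) / t%:C%C.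
  by apply/funext => z; rewrite /v /kker conjc0 mul0r subr0 divr1.
(* At the point 0 the Blaschke factor is z and the denominator of kker is 1. *)
have gamE : (fun z => z * gam z) = (fun z => blaschke 0 z * sub_inner phi 0 z).
  by apply/funext => z; rewrite /blaschke conjc0 mul0r !subr0 divr1.
have KphiE : modelK phi = mulset v (modelK (fun z => z * gam z)).
  by rewrite vE gamE; exact: modelK_crofoot phiI D0 b1 t t_neq0.
have mv : measT v.
  by rewrite vE; exact: Hinf_measT (Hinf_mul (Hinf_1B_inner 0 phiI) (Hinf_cst _)).
have Kmeas' h : modelK (fun z => z * gam z) h -> measT h by exact: kerT_measT.
have viso h : modelK (fun z => z * gam z) h -> normT (fun z => v z * h z) = normT h.
  by rewrite vE gamE => Kh; exact: (modelK_crofoot_norm phiI D0 b1 t0 tE Kh).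
have kerE' : kerT symb = mulset (fun z => m_mult lam th z * v z) (modelK (fun z => z * gam z)).
  by rewrite kerE KphiE mulset_comp.
have mmv : measT (fun z => m_mult lam th z * v z) := measT_mul mm mv.
split; [|split; [by split|split]].
- move=> mu muD; have := kerT_blaschke hth muD (lt1 mu muD) hlam (oner_neq0 R).
  by under [fun z => _ / _]eq_fun do rewrite rmorph1 divr1.
- by exists f.
(* The multiplier is c (1 - conj a th) (1 - conj b phi) with c = 1 / (s t). *)
- have c0 : 0 < s^-1 * t^-1 by rewrite mulr_gt0 ?invr_gt0.
  have [H2th _] := inner_Hinf hth; have [H2phi _] := inner_Hinf phiI.
  have bd h (c : R[i]) : inner h -> aeT (fun z => normc (conjc c * h z) <= normc c).
    by move=> /innerP[_]; apply: aeT_mp => z _ h1; rewrite Normc.normcM normcJ h1 mulr1.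
  apply: (outer_prod_1B c0 (H2_scale (conjc a) H2th) (H2_scale (conjc b) H2phi) a1 b1
    (bd _ _ hth) (bd _ _ phiI) mmv).
  apply: eqT_circle => z z1; rewrite mE// vE.
  by rewrite rmorphM !fmorphV; ring.
- exact: inner_sub_inner.
- exact: kerE'.
- apply: (isometric_multiplier_mulset mmv Kmeas' kerE') => h Kh.
  rewrite -(viso h Kh) -[RHS]miso; last first.
    rewrite KphiE; split; first exact: measT_mul mv (Kmeas' _ Kh).
    by exists h => //; exact: eqT_refl.
  by apply: normT_eq => z _; rewrite mulrA.
Qed.
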